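(* Fix $d \geq 2$. For all $\lambda > (d-1)^2/4$ and all $p$ with $0 < p < \frac{4}{d-2}$ (for $d=2$ this means $0<p<\infty$), there exists a solution to the nonlinear Schrödinger equation $$ i u_t + \Delta_{\mathbb{H}^d} u + |u|^p u = 0 $$ on hyperbolic space $\mathbb{H}^d$ of the form $$ u(t,\Omega) = e^{i\lambda t} R_\lambda(\Omega), \qquad \Omega \in \mathbb{H}^d, $$ where $R_\lambda$ is a positive, decreasing, spherically symmetric solution of the stationary equation $$ -\Delta_{\mathbb{H}^d} R_\lambda + \lambda R_\lambda - R_\lambda^{p+1} = 0 . $$
   Context: $\mathbb{H}^d$ is $d$-dimensional hyperbolic space (constant sectional curvature $-1$), described in polar coordinates $(r,\omega)$, $r\ge 0$, $\omega\in\mathbb{S}^{d-1}$, about a fixed origin $0$, with metric $ds^2 = dr^2 + \sinh^2 r\, d\omega^2$. $\Delta_{\mathbb{H}^d}$ is the (non-positive definite) Laplacian on $\mathbb{H}^d$, $$\Delta_{\mathbb{H}^d} = \partial_r^2 + (d-1)\frac{\cosh r}{\sinh r}\partial_r + \frac{1}{\sinh^2 r}\Delta_{\mathbb{S}^{d-1}}.$$ A function on $\mathbb{H}^d$ is spherically symmetric if it depends only on the hyperbolic distance $r$ to the origin; ''decreasing'' means decreasing as a function of $r$. *)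

(* Defs.v *)
From HB Require Import structures.
From mathcomp Require Export all_boot all_order all_algebra.
From mathcomp Require Export complex.
From mathcomp Require Export all_classical all_reals all_analysis.

Set Implicit Arguments.
Unset Strict Implicit.
Unset Printing Implicit Defensive.

Export Order.TTheory GRing.Theory Num.Theory.
Export numFieldNormedType.Exports.

Local Open Scope classical_set_scope.
Local Open Scope ring_scope.
Local Open Scope complex_scope.

(* Hyperbolic space in geodesic normal coordinates at the origin: the point
   with polar coordinates (r, omega) is the vector r *: omega of R^d, omega
   being a unit vector.  The hyperbolic exponential map at the origin is a
   global diffeomorphism, so this identifies H^d with R^d as smooth manifolds
   (but not as Riemannian manifolds). *)
Notation hyperbolic R d := 'rV[R]_d (only parsing).

Definition cosh (R : realType) (x : R) : R := (expR x + expR (- x)) / 2.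
Definition sinh (R : realType) (x : R) : R := (expR x - expR (- x)) / 2.

(* The library norm `|x| on row vectors is the sup norm.  On [hyperbolic R d]
   the Euclidean norm is the hyperbolic distance to the origin. *)
Definition enorm (R : realType) (d : nat) (x : 'rV[R]_d) : R :=
  Num.sqrt (\sum_(i < d) x ord0 i ^+ 2).

Definition vecE (R : realType) (d : nat) (i : 'I_d) : 'rV[R]_d :=
  delta_mx ord0 i.

Definition partial (R : realType) (d : nat) (i : 'I_d) (f : 'rV[R]_d -> R) :
  'rV[R]_d -> R := fun x => 'D_(vecE R i) f x.

Definition C2 (R : realType) (d : nat) (f : 'rV[R]_d -> R) : Prop :=
  [/\ continuous f,
      (forall i x, derivable f x (vecE R i)),
      (forall i, continuous (partial i f)),
      (forall i j x, derivable (partial i f) x (vecE R j)) &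
      (forall i j, continuous (partial j (partial i f)))].

Definition euclidean_laplacian (R : realType) (d : nat) (f : 'rV[R]_d -> R)
    (x : 'rV[R]_d) : R :=
  \sum_(i < d) partial i (partial i f) x.

(* Laplace-Beltrami operator of the unit sphere: the Euclidean Laplacian of the
   extension of g that is homogeneous of degree 0.  Only the values of g on the
   unit sphere matter. *)
Definition sphere_laplacian (R : realType) (d : nat) (g : 'rV[R]_d -> R)
    (omega : 'rV[R]_d) : R :=
  euclidean_laplacian (fun y => g ((enorm y)^-1 *: y)) omega.

(* The polar formula degenerates at the origin.  There the metric agrees with
   the Euclidean one to first order, so the Laplacian is the Euclidean one; for
   a C^2 function this is the limit of the polar expression as r tends to 0. *)
Definition hyperbolic_laplacian (R : realType) (d : nat)
    (f : hyperbolic R d -> R) (x : hyperbolic R d) : R :=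
  if x == 0 then euclidean_laplacian f 0 else
  let r := enorm x in
  let omega := r^-1 *: x in
  let h := fun s : R => f (s *: omega) in
  derive1n 2 h r + (d%:R - 1) * (cosh r / sinh r) * derive1 h r
  + (sinh r ^+ 2)^-1 * sphere_laplacian (fun theta => f (r *: theta)) omega.

Definition spherically_symmetric (R : realType) (d : nat)
    (f : hyperbolic R d -> R) : Prop :=
  forall x y, enorm x = enorm y -> f x = f y.

(* Strict: constants are excluded. *)
Definition radially_decreasing (R : realType) (d : nat)
    (f : hyperbolic R d -> R) : Prop :=
  forall x y, enorm x < enorm y -> f y < f x.

(* Classical solutions; the unknown is positive, so [powR] is the usual power. *)
Definition stationary_solution (R : realType) (d : nat) (lambda p : R)
    (f : hyperbolic R d -> R) : Prop :=
  C2 f /\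
  forall x, - hyperbolic_laplacian f x + lambda * f x - f x `^ (p + 1) = 0.

(* The library has no normed-module structure over R on R[i]: complex-valued
   functions of real variables are differentiated componentwise. *)
Definition ReF (R : realType) (T : Type) (f : T -> R[i]) : T -> R :=
  fun x => complex.Re (f x).
Definition ImF (R : realType) (T : Type) (f : T -> R[i]) : T -> R :=
  fun x => complex.Im (f x).

Definition cderivable (R : realType) (f : R -> R[i]) (t : R) : Prop :=
  derivable (ReF f) t 1 /\ derivable (ImF f) t 1.

Definition cderive (R : realType) (f : R -> R[i]) (t : R) : R[i] :=
  derive1 (ReF f) t +i* derive1 (ImF f) t.

Definition hyperbolic_claplacian (R : realType) (d : nat)
    (f : hyperbolic R d -> R[i]) (x : hyperbolic R d) : R[i] :=
  hyperbolic_laplacian (ReF f) x +i* hyperbolic_laplacian (ImF f) x.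

(* e^{i theta} *)
Definition cis (R : realType) (theta : R) : R[i] := cos theta +i* sin theta.

Definition nls_solution (R : realType) (d : nat) (p : R)
    (u : R -> hyperbolic R d -> R[i]) : Prop :=
  [/\ forall t, C2 (ReF (u t)) /\ C2 (ImF (u t)),
      forall t x, cderivable (fun s => u s x) t &
      forall t x,
        (0 +i* 1) * cderive (fun s => u s x) t + hyperbolic_claplacian (u t) x
        + (Normc.normc (u t x) `^ p)%:C * u t x = 0].

(* Main.v *)
Require Import Defs.
From mathcomp Require Import ring lra.

Set Implicit Arguments.
Unset Strict Implicit.
Unset Printing Implicit Defensive.

Local Open Scope classical_set_scope.
Local Open Scope ring_scope.
Local Open Scope complex_scope.

(** The statement asks for a positive decreasing radial solution of the
    stationary equation; the standing wave then solves the evolution equation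
    by a direct computation ([standing_wave]).  A radial profile [phi] must solve
    [phi'' + (d - 1) coth r phi' - lambda phi + phi ^ (p + 1) = 0] with
    [phi'(0) = 0], which is done by shooting on [phi(0)].

    Put [n = d - 1], [phi r = eps ^ (- 2 / p) v (r / eps)].  The problem becomes
    [v'' + n eps coth (eps s) v' + v ^ (p + 1) - lambda eps ^ 2 v = 0] with
    [v(0) = 1], [v'(0) = 0], where [phi(0)] large corresponds to [eps] small, and
    which makes sense at [eps = 0], where it is the Lane-Emden equation of
    Euclidean space.  After truncation of the nonlinearity to values of [v] in
    [[0, 1]], the problem is globally solvable by Picard iteration for the
    integrated form [(w v')' = - w f(v)] ([radsol_exists]), and its solutions
    depend continuously on [eps], up to and including 0 ([fam_dependence]).

    At [eps = 0] the solution takes a negative value: otherwise it would be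
    positive and decreasing, and the Pohozaev functional, which increases in
    the subcritical range [p < 4 / (d - 2)], would contradict the decay
    [v ^ p <= C / s ^ 2] ([lane_emden_contradiction]).  For some [eps = e1] with
    [lambda e1 ^ 2 < 1] the energy [v' ^ 2 / 2 + F(v)] is negative at [s = 0];
    being nonincreasing, it prevents [v] from vanishing ([energy_neg_pos]).  Let
    [eps] be the supremum of the parameters in [[0, e1]] whose solution takes a
    negative value.  That condition is open, so the solution at the supremum is
    nonnegative, and having negative energy at some time before which the
    solution is positive is open too, so this does not happen at the supremum.
    By [monotone_or_negative_energy] the solution is therefore decreasing on
    the whole half line, hence positive ([shooting]).  Decay at infinity is not
    part of the claim and is not needed.

    Finally [v'' (0) = - f(1) / d] ([u_slope]) makes [phi (enorm x)] twice
    continuously differentiable at the origin ([radial_C2]). *)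

(** * Calculus on the real line *)

(** [der F x l]: the function [F] of one real variable has derivative [l] at
    [x].  Unlike [is_derive] it is not a class, so that its proofs are
    always explicit. *)
Definition der (R : realType) (F : R -> R) (x l : R) : Prop :=
  is_derive x 1 F l.

Section Calculus.
Context {R : realType}.
Implicit Types (F G f g : R -> R) (a b s t x : R).

Lemma der_ext F G x l m : F = G -> l = m -> der F x l -> der G x m.
Proof. by move=> -> ->. Qed.

Lemma derD F G x l m :
  der F x l -> der G x m -> der (fun s => F s + G s) x (l + m).
Proof. by move=> dF dG; exact: (is_deriveD dF dG). Qed.

Lemma derN F x l : der F x l -> der (fun s => - F s) x (- l).
Proof. by move=> dF; exact: (is_deriveN dF). Qed.

Lemma derB F G x l m :
  der F x l -> der G x m -> der (fun s => F s - G s) x (l - m).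
Proof. by move=> dF dG; exact: (is_deriveB dF dG). Qed.

Lemma derM F G x l m : der F x l -> der G x m ->
  der (fun s => F s * G s) x (F x * m + G x * l).
Proof. by move=> dF dG; exact: (is_deriveM dF dG). Qed.

Lemma derZ c F x l : der F x l -> der (fun s => c * F s) x (c * l).
Proof. by move=> dF; exact: (is_deriveZ c dF). Qed.

Lemma derX F n x l : der F x l ->
  der (fun s => F s ^+ n) x (n%:R * F x ^+ n.-1 * l).
Proof.
move=> dF; apply: der_ext (is_deriveX n dF) => //.
by apply/funext => s; elim: n => [|n IH]; rewrite ?expr0// exprS fctE IH exprS.
Qed.

Lemma der_comp F G x l m :
  der F (G x) l -> der G x m -> der (fun s => F (G s)) x (l * m).
Proof.
move=> dF dG; apply: der_ext (is_derive1_comp dF dG) => //; rewrite mulrC.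
Qed.

Lemma der_cst c x : der (fun=> c) x 0.
Proof. exact: is_derive_cst. Qed.

Lemma der_id x : der (fun s => s) x 1.
Proof. exact: is_derive_id. Qed.

Lemma der_exp x : der expR x (expR x).
Proof. exact: is_derive_expR. Qed.

Lemma der_cont F x l : der F x l -> {for x, continuous F}.
Proof.
by case=> dF _; apply/differentiable_continuous/derivable1_diffP.
Qed.

Lemma der_near F G x l : (\near x, F x = G x) -> der F x l -> der G x l.
Proof. by move=> FG; exact: near_eq_is_derive. Qed.

Lemma mvt F (dF : R -> R) a b : a < b ->
  (forall x, a < x < b -> der F x (dF x)) ->
  (forall x, a <= x <= b -> {for x, continuous F}) ->
  exists2 c, a < c < b & F b - F a = dF c * (b - a).
Proof.
move=> ab dFx cF; have cF' : {within `[a, b], continuous F}.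
  by apply: continuous_in_subspaceT => x; rewrite inE/= in_itv/=; exact: cF.
have dF' x : x \in `]a, b[ -> is_derive x 1 F (dF x).
  by rewrite in_itv/=; exact: dFx.
by have [c cab ->] := MVT ab dF' cF'; exists c => //; move: cab; rewrite in_itv.
Qed.

Lemma nincr_le F (dF : R -> R) a b : a <= b ->
  (forall x, a < x < b -> der F x (dF x)) ->
  (forall x, a <= x <= b -> {for x, continuous F}) ->
  (forall x, a < x < b -> dF x <= 0) -> F b <= F a.
Proof.
rewrite le_eqVlt => /predU1P[->//|ab] dFx cF le0.
have [c cab] := mvt ab dFx cF; rewrite -subr_le0 => ->.
by rewrite mulr_le0_ge0 ?le0// subr_ge0 ltW.
Qed.

Lemma decr_lt F (dF : R -> R) a b : a < b ->
  (forall x, a < x < b -> der F x (dF x)) ->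
  (forall x, a <= x <= b -> {for x, continuous F}) ->
  (forall x, a < x < b -> dF x < 0) -> F b < F a.
Proof.
move=> ab dFx cF lt0.
have [c cab] := mvt ab dFx cF; rewrite -subr_lt0 => ->.
by rewrite nmulr_rlt0 ?lt0// subr_gt0.
Qed.

(** A bound on derivatives integrates to a bound on increments. *)
Lemma der_bound F G (dF dG : R -> R) a b : a <= b ->
  (forall x, a < x < b -> der F x (dF x)) ->
  (forall x, a < x < b -> der G x (dG x)) ->
  (forall x, a <= x <= b -> {for x, continuous F}) ->
  (forall x, a <= x <= b -> {for x, continuous G}) ->
  (forall x, a < x < b -> `|dF x| <= dG x) -> `|F b - F a| <= G b - G a.
Proof.
move=> ab dFx dGx cF cG le; rewrite ler_norml; apply/andP; split.
  have := @nincr_le (fun x => - F x - G x) (fun x => - dF x - dG x) a b ab.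
  move=> H; rewrite -subr_ge0.
  suff : - F b - G b <= - F a - G a by lra.
  apply: H => x xab.
  - by apply: derB; [apply: derN; exact: dFx|exact: dGx].
  - by apply: continuousB; [apply: continuousN; exact: cF|exact: cG].
  - by have := le _ xab; rewrite ler_norml; lra.
have := @nincr_le (fun x => F x - G x) (fun x => dF x - dG x) a b ab.
move=> H; suff : F b - G b <= F a - G a by lra.
apply: H => x xab.
- by apply: derB; [exact: dFx|exact: dGx].
- by apply: continuousB; [exact: cF|exact: cG].
- by have := le _ xab; rewrite ler_norml; lra.
Qed.

Lemma near_pos g x : 0 < x -> \near x, g x = g (Num.max x 0).
Proof.
move=> x0; near=> y; rewrite max_l//; apply: ltW; near: y.
exact: lt_nbhsr.
Unshelve. all: by end_near. Qed.

(** Continuous functions have primitives on the half line, extended by 0 to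
    the left of the origin. *)
Lemma primitive g : continuous g ->
  exists G, [/\ continuous G, G 0 = 0 & forall x, 0 < x -> der G x (g x)].
Proof.
move=> cg.
(* Starting the integral at -1 makes 0 an interior point. *)
pose F (x : R) := (\int[lebesgue_measure]_(t in [set` `[-1, x]]) g t)%R.
have dF x : 0 <= x -> der F x (g x).
  move=> x0; have xx : x < x + 1 by lra.
  have ax : -1 < x by lra.
  have gi : lebesgue_measure.-integrable `[-1, x + 1] (EFin \o g).
    apply: continuous_compact_integrable; first exact: segment_compact.
    exact: continuous_subspaceT.
  have [d1 d2] := continuous_FTC1_closed xx gi ax (cg x).
  by split; [exact: d1|rewrite -derive1E].
exists (fun x => F (Num.max x 0) - F 0); split => [x||x x0].
- apply: cvgB; last exact: cvg_cst.
  apply: (@continuous_comp _ _ _ (fun x => Num.max x 0) F).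
    by apply: continuous_max; [exact: cvg_id|exact: cvg_cst].
  by apply: der_cont; apply: dF; rewrite le_max lexx orbT.
- by rewrite maxxx subrr.
- rewrite -[g x]subr0; apply: derB; last exact: der_cst.
  by apply: der_near (dF _ (ltW x0)); exact: near_pos.
Qed.

(** The first zero of a continuous function that changes sign. *)
Lemma first_zero g a b : a <= b -> continuous g -> 0 < g a -> g b <= 0 ->
  exists z, [/\ a < z <= b, g z = 0 & forall x, a <= x < z -> 0 < g x].
Proof.
move=> ab cg ga gb.
pose A := [set x | a <= x /\ forall y, a <= y <= x -> 0 < g y].
have Aa : A a by split=> // y; rewrite -eq_le => /eqP <-.
have Ab : ubound A b.
  move=> x [ax Ax]; rewrite leNgt; apply/negP => bx.
  by have := Ax b; rewrite ab (ltW bx) => /(_ isT); rewrite ltNge gb.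
have supA : has_sup A by split; [exists a|exists b].
pose z := sup A.
have az : a <= z by exact: sup_upper_bound.
have zb : z <= b by apply: ge_sup => //; exists a.
have pos x : a <= x < z -> 0 < g x.
  move=> /andP[ax xz]; have e0 : 0 < z - x by rewrite subr_gt0.
  have [y [ay Ay] yz] := sup_adherent e0 supA.
  by apply: Ay; move: yz; rewrite ax -/z/=; lra.
have gz0 : g z <= 0.
  rewrite leNgt; apply/negP => gz.
  have /nbhs_ballP[e /= e0 He] : \near z, 0 < g z.
    exact: (@cvgr_gt _ _ _ _ g _ (cg z)).
  have : A (z + e / 2).
    split=> [|y /andP[ay yz]]; first by lra.
    have [yz'|zy] := ltP y z; first by apply: pos; rewrite ay.
    by apply: He; rewrite /ball/= ltr_norml; lra.
  by move/(sup_upper_bound supA); rewrite -/z; lra.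
have za : a < z.
  by rewrite lt_neqAle az andbT; apply/eqP => E; move: gz0; rewrite -E leNgt ga.
exists z; split => //; first by rewrite za zb.
apply/eqP; rewrite eq_le gz0/= leNgt; apply/negP => gz.
have /nbhs_ballP[e /= e0 He] : \near z, g z < 0.
  exact: (@cvgr_lt _ _ _ _ g _ (cg z)).
pose y := Num.max a (z - e / 2).
have : g y < 0.
  by apply: He; rewrite /ball/= /y; case: (leP a (z - e / 2)) => ?;
    rewrite ltr_norml; lra.
have : 0 < g y.
  by apply: pos; rewrite /y le_max lexx gt_max za/=; lra.
lra.
Qed.

End Calculus.

(** * Radial initial value problems *)

(** A weight is a density that vanishes at the origin only and is
    nondecreasing, such as the area of a geodesic sphere. *)
Definition weight (R : realType) (w : R -> R) : Prop :=
  [/\ continuous w, w 0 = 0, forall s, 0 < s -> 0 < w s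
    & forall s t, 0 <= s -> s <= t -> w s <= w t].

(** Solutions of [(w v')' = - w f(v)], [v(0) = 1], [v'(0) = 0] on the half
    line; [u] is the derivative of [v].  The values at negative arguments are
    irrelevant, up to continuity. *)
Record radsol (R : realType) (w f v u : R -> R) : Prop := Radsol {
  radsol_contv : continuous v;
  radsol_contu : continuous u;
  radsol_v0 : v 0 = 1;
  radsol_u0 : u 0 = 0;
  radsol_derv : forall s, 0 < s -> der v s (u s);
  radsol_deru : forall s, 0 < s ->
    der (fun t => w t * u t) s (- (w s * f (v s)))
}.

Section Existence.
Context {R : realType}.
Implicit Types (w f v u U V H h : R -> R) (s t x kappa : R).

Lemma contM f v : continuous f -> continuous v ->
  continuous (fun s => f s * v s).
Proof. by move=> cf cv x; apply: cvgM; [exact: cf|exact: cv]. Qed.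

Lemma contD f v : continuous f -> continuous v ->
  continuous (fun s => f s + v s).
Proof. by move=> cf cv x; apply: cvgD; [exact: cf|exact: cv]. Qed.

Lemma contN f : continuous f -> continuous (fun s => - f s).
Proof. by move=> cf x; apply: cvgN; exact: cf. Qed.

Lemma contB f v : continuous f -> continuous v ->
  continuous (fun s => f s - v s).
Proof. by move=> cf cv x; apply: cvgB; [exact: cf|exact: cv]. Qed.

Lemma cont_cst (c : R) : continuous (fun _ : R => c).
Proof. by move=> x; exact: cvg_cst. Qed.

Lemma contZ c f : continuous f -> continuous (fun s => c * f s).
Proof. by move=> cf; apply: contM => //; exact: cont_cst. Qed.

Lemma cont_comp f v : continuous f -> continuous v ->
  continuous (fun s => f (v s)).
Proof.
by move=> cf cv x; apply: (@continuous_comp _ _ _ v f); [exact: cv|exact: cf].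
Qed.

Lemma contX f n : continuous f -> continuous (fun s => f s ^+ n).
Proof. by move=> cf; apply: (cont_comp (@exprn_continuous R n)). Qed.

Lemma cont_id : continuous (fun s : R => s).
Proof. by move=> x; exact: cvg_id. Qed.

Lemma lip_cont f x (K : R) :
  (forall y, `|y - x| < 1 -> `|f y - f x| <= K * `|y - x|) ->
  {for x, continuous f}.
Proof.
move=> lip; apply/(@cvgrPdist_lt _ _ _ _ _ f) => e e0.
have K1 : 0 < `|K| + 1 by rewrite ltr_wpDl.
near=> y; have yx : `|y - x| < 1.
  by near: y; apply: (@cvgr_distC_lt _ _ _ _ _ (fun y => y)) => //; exact: cvg_id.
have yx' : `|y - x| < e / (`|K| + 1).
  near: y; apply: (@cvgr_distC_lt _ _ _ _ _ (fun y => y)); first exact: cvg_id.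
  by rewrite divr_gt0.
rewrite distrC (le_lt_trans (lip _ yx))//.
apply: (@le_lt_trans _ _ ((`|K| + 1) * `|y - x|)).
  by rewrite ler_wpM2r// (le_trans (ler_norm K))// lerDl.
by rewrite mulrC -ltr_pdivlMr.
Unshelve. all: by end_near. Qed.

(** Letting a geometric error tend to 0. *)
Lemma geo_le (x K C : R) : (forall n, x <= K + C / 2 ^+ n) -> x <= K.
Proof.
move=> le; apply/ler_addgt0Pr => e e0.
have C1 : 0 < `|C| + 1 by rewrite ltr_wpDl.
have [n ne] : exists n, (`|C| + 1) / e < n%:R :> R.
  by exists (Num.bound ((`|C| + 1) / e)); rewrite archi_boundP ?divr_ge0 ?ltW.
have n2 : n%:R < 2 ^+ n :> R by rewrite -natrX ltr_nat ltn_expl.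
apply: (le_trans (le n)); rewrite lerD2l ler_pdivrMr ?exprn_gt0//.
apply: (@le_trans _ _ (`|C| + 1)); first by rewrite (le_trans (ler_norm C))// lerDl.
rewrite mulrC -ler_pdivrMr//; apply: ltW; exact: lt_trans ne n2.
Qed.

(** Geometrically small increments give convergence at the same rate.  With
    [e n := 2 C / 2 ^+ n], the sequence [a - e] increases, [a + e] decreases,
    and the limit is the supremum of the former. *)
Lemma geo_lim (a : nat -> R) (C : R) :
  (forall n, `|a n.+1 - a n| <= C / 2 ^+ n) ->
  exists l, forall n, `|a n - l| <= 2 * C / 2 ^+ n.
Proof.
move=> le.
pose e n := 2 * C / 2 ^+ n.
have eS n : e n = 2 * e n.+1.
  by rewrite /e exprS; field; rewrite expf_neq0// pnatr_eq0.
have leS n : `|a n.+1 - a n| <= e n.+1.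
  by rewrite (le_trans (le n))// /e exprS le_eqVlt; apply/orP; left;
    apply/eqP; field; rewrite expf_neq0// pnatr_eq0.
have e0 n : 0 <= e n.
  by have := le_trans (normr_ge0 _) (leS n); rewrite (eS n); lra.
have bS n k : a n - e n <= a (n + k)%N - e (n + k)%N.
  elim: k => [|k IH]; first by rewrite addn0.
  apply: (le_trans IH); rewrite addnS.
  by have := leS (n + k)%N; have := eS (n + k)%N; rewrite ler_norml; lra.
have cS n k : a (n + k)%N + e (n + k)%N <= a n + e n.
  elim: k => [|k IH]; first by rewrite addn0.
  apply: (le_trans _ IH); rewrite addnS.
  by have := leS (n + k)%N; have := eS (n + k)%N; rewrite ler_norml; lra.
have bc n m : a n - e n <= a m + e m.
  apply: (le_trans (bS n m)); apply: (le_trans _ (cS m n)).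
  by rewrite addnC; have := e0 (m + n)%N; lra.
pose A := [set a n - e n | n in setT].
have A0 : A !=set0 by exists (a 0%N - e 0%N); exists 0%N.
have Ab m : ubound A (a m + e m) by move=> _ [n _ <-].
exists (sup A) => n; rewrite -/(e n).
have h1 : sup A <= a n + e n by apply: ge_sup.
have h2 : a n - e n <= sup A.
  by apply: sup_upper_bound; [split=> //; exists (a 0%N + e 0%N)|exists n].
by rewrite ler_norml; lra.
Qed.

(** If [(w U)' = w h] then [U] is bounded by the integral of [`|h|]: as [w] is
    nondecreasing, [w t / w s] is at most 1 for [t <= s]. *)
Lemma weight_step w U h H (dH : R -> R) s : weight w -> continuous U ->
  continuous H -> 0 <= s ->
  (forall t, 0 < t -> der (fun r => w r * U r) t (w t * h t)) ->
  (forall t, 0 < t -> der H t (dH t)) ->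
  (forall t, 0 < t < s -> `|h t| <= dH t) -> U 0 = 0 ->
  `|U s| <= H s - H 0.
Proof.
move=> [cw w0 wp wm] cU cH; rewrite le_eqVlt => /predU1P[<- _ _ _ ->|s0].
  by rewrite subrr normr0.
move=> dU dHt hH _; have ws := wp _ s0.
rewrite -(ler_pM2l ws) mulrBr -{1}(gtr0_norm ws) -normrM.
have -> : w s * U s = w s * U s - w 0 * U 0 by rewrite w0 mul0r subr0.
apply: (@der_bound R (fun r => w r * U r) (fun r => w s * H r)
  (fun t => w t * h t) (fun t => w s * dH t)) => [||||t _|t ts].
- exact: ltW.
- by move=> t /andP[t0 _]; exact: dU.
- by move=> t /andP[t0 _]; apply: derZ; exact: dHt.
- by move=> t _; apply: contM.
- by apply: contZ.
have /andP[t0 lts] := ts.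
rewrite normrM ler_pM//; last exact: hH.
by rewrite gtr0_norm ?wp// wm ?ltW.
Qed.

Lemma der_expZ kappa t : der (fun s => expR (kappa * s)) t (kappa * expR (kappa * t)).
Proof.
apply: der_ext (der_comp (der_exp _) (derZ kappa (der_id t))) => //.
by rewrite mulr1 mulrC.
Qed.

Lemma cont_expZ kappa : continuous (fun s => expR (kappa * s)).
Proof. by move=> t; exact: (der_cont (der_expZ kappa t)). Qed.

(** The basic estimate: two integrations gain the factor [kappa ^- 2] in the
    exponentially weighted sup norm. *)
Lemma weight_step_exp w U V h kappa (B eta S : R) : weight w ->
  continuous U -> continuous V -> U 0 = 0 -> 0 < kappa -> 0 <= B ->
  (forall t, 0 < t -> der (fun r => w r * U r) t (w t * h t)) ->
  (forall t, 0 < t -> der V t (U t)) ->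
  (forall t, 0 < t < S -> `|h t| <= B * expR (kappa * t) + eta) ->
  forall s, 0 <= s <= S ->
    `|U s| <= B / kappa * expR (kappa * s) + eta * s /\
    `|V s - V 0| <= B / kappa ^+ 2 * expR (kappa * s) + eta * (s ^+ 2 / 2).
Proof.
move=> ww cU cV U0 k0 B0 dU dV hle.
have kn0 : kappa != 0 by rewrite gt_eqF.
have Us s : 0 <= s <= S -> `|U s| <= B / kappa * expR (kappa * s) + eta * s.
  move=> /andP[s0 sS].
  pose H t := B / kappa * expR (kappa * t) + eta * t.
  have cH : continuous H.
    by apply: contD; apply: contZ; [exact: cont_expZ|exact: cont_id].
  have dH t : der H t (B * expR (kappa * t) + eta).
    apply: der_ext (derD (derZ _ (der_expZ kappa t)) (derZ eta (der_id t))) => //.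
    by field.
  have := @weight_step w U h H _ s ww cU cH s0 dU (fun t _ => dH t) _ U0.
  move=> /(_ _)/le_trans; apply => [t /andP[t0 ts]|].
    by apply: hle; rewrite t0 (lt_le_trans ts sS).
  by rewrite {2}/H !mulr0 expR0 mulr1 addr0 -/(H s) gerBl divr_ge0// ltW.
move=> s /andP[s0 sS]; split; first by apply: Us; rewrite s0.
pose K t := B / kappa ^+ 2 * expR (kappa * t) + eta * (t ^+ 2 / 2).
have dK t : der K t (B / kappa * expR (kappa * t) + eta * t).
  apply: (@der_ext _ (fun t => B / kappa ^+ 2 * expR (kappa * t) + eta / 2 * t ^+ 2)).
  - by apply/funext => r; rewrite /K; field.
  - exact: erefl.
  - apply: der_ext (derD (derZ _ (der_expZ kappa t)) (derZ _ (derX 2 (der_id t)))).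
      exact: erefl.
    by rewrite expr1; field.
apply: (@le_trans _ _ (K s - K 0)).
  apply: (@der_bound R V K U _ 0 s s0) => [x /andP[x0 _]|x _|x _|x _|x /andP[x0 xs]].
  - exact: dV.
  - exact: dK.
  - exact: cV.
  - exact: der_cont (dK x).
  - by apply: Us; rewrite (ltW x0) (le_trans (ltW xs)).
rewrite {2}/K -/(K s) expr0n/= mul0r !mulr0 addr0 expR0 mulr1 gerBl.
by rewrite divr_ge0// exprn_ge0// ltW.
Qed.

End Existence.

Section Picard.
Context {R : realType}.
Variables (w f : R -> R) (L : R).
Hypotheses (ww : weight w) (f1 : forall x, `|f x| <= 1).
Hypothesis fL : forall x y, `|f x - f y| <= L * `|x - y|.

Lemma lipschitz_continuous : continuous f.
Proof. by move=> x; apply: (@lip_cont _ _ _ L) => y _; exact: fL. Qed.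

Lemma max0_dist (x y : R) : `|Num.max y 0 - Num.max x 0| <= `|y - x|.
Proof.
have := ler_norm (y - x); have := ler_norm (x - y); rewrite distrC.
by case: (leP y 0) => ?; case: (leP x 0) => ? ? ?; rewrite ler_norml; lra.
Qed.

(** One step of the Picard iteration: [U = - w^-1 \int_0^s w f(v)] extends
    continuously by 0 to the origin because [`|U s| <= s], and the first
    component of the result is [1 + \int_0^s U]. *)
Lemma picard_op v : continuous v -> exists VU : (R -> R) * (R -> R),
  [/\ continuous VU.1, continuous VU.2, VU.1 0 = 1, VU.2 0 = 0 &
    forall s, 0 < s -> der VU.1 s (VU.2 s) /\
      der (fun t => w t * VU.2 t) s (w s * - f (v s))].
Proof.
move=> cv; have [cw w0 wp wm] := ww.
have cf := lipschitz_continuous.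
have cwf : continuous (fun s => w s * - f (v s)).
  by apply: contM => //; apply: contN; apply: cont_comp.
have [P [cP P0 dP]] := primitive cwf.
pose U s := if s <= 0 then 0 else P s / w s.
have Upos s : 0 < s -> U s = P s / w s by rewrite /U leNgt => ->.
have Uneg s : s <= 0 -> U s = 0 by rewrite /U => ->.
have wU s : 0 < s -> w s * U s = P s.
  by move=> s0; rewrite Upos// mulrC divfK// gt_eqF// wp.
have Ule s : 0 < s -> `|U s| <= s.
  move=> s0; rewrite -(ler_pM2l (wp _ s0)) -{1}(gtr0_norm (wp _ s0)) -normrM wU//.
  have -> : P s = P s - P 0 by rewrite P0 subr0.
  have -> : w s * s = w s * s - w s * 0 by rewrite mulr0 subr0.
  apply: (@der_bound R P (fun t => w s * t) (fun t => w t * - f (v t))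
    (fun=> w s)) => [||x _|x _|x _|x /andP[x0 xs]].
  - exact: ltW.
  - by move=> x /andP[x0 _]; exact: dP.
  - by have := derZ (w s) (der_id x); rewrite mulr1.
  - exact: cP.
  - by apply: contZ; exact: cont_id.
  - rewrite normrM normrN gtr0_norm ?wp//.
    rewrite -[leRHS]mulr1; apply: ler_pM => //; first exact: ltW (wp _ _).
    by apply: wm; exact: ltW.
have cU : continuous U.
  move=> x; have [x0|x0] := ltP 0 x; last first.
    apply: (@lip_cont _ U x 1) => y _; rewrite (Uneg x)// subr0 mul1r.
    have [y0|y0] := leP y 0; first by rewrite Uneg// normr0.
    by rewrite (le_trans (Ule _ y0))// ler_normr; lra.
  have : {for x, continuous (fun s => P s / w s)}.
    by apply: continuousM; [exact: cP|apply: continuousV; [rewrite gt_eqF ?wp|exact: cw]].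
  rewrite /prop_for /continuous_at Upos//; apply: cvg_trans.
  apply: near_eq_cvg; near=> y; rewrite Upos//; near: y; exact: lt_nbhsr.
have [G [cG G0 dG]] := primitive cU.
exists (fun s => 1 + G s, U); split => //=.
- by apply: contD; [exact: cont_cst|].
- by rewrite G0 addr0.
- by rewrite Uneg.
move=> s s0; split.
  by have := derD (der_cst 1 s) (dG _ s0); rewrite add0r.
apply: der_near (dP _ s0); near=> y; rewrite wU//; near: y; exact: lt_nbhsr.
Unshelve. all: by end_near. Qed.

(** The Picard iterates converge: in the norm weighted by [expR (- kappa s)]
    one step is a contraction of factor [L / kappa ^+ 2 <= 1 / 2]. *)
Theorem radsol_exists : exists v u, radsol w f v u.
Proof.
have /choice[op opP] : forall v, exists o : (R -> R) * (R -> R),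
    continuous v -> [/\ continuous o.1, continuous o.2, o.1 0 = 1, o.2 0 = 0 &
    forall s, 0 < s -> der o.1 s (o.2 s) /\
      der (fun t => w t * o.2 t) s (w s * - f (v s))].
  move=> v; have [cv|ncv] := pselect (continuous v); last by exists (v, v) => /ncv.
  by have [VU H] := picard_op cv; exists VU.
have [cw w0 wp wm] := ww.
have L0 : 0 <= L by have := le_trans (normr_ge0 _) (fL 1 0); rewrite subr0 normr1 mulr1.
(* Any kappa >= 1 with 2 L <= kappa ^ 2 will do. *)
pose kappa := 2 * L + 1.
have k1 : 1 <= kappa by rewrite /kappa; lra.
have kL : 2 * L <= kappa ^+ 2.
  by apply: (@le_trans _ _ kappa); [rewrite /kappa; lra|rewrite expr2 ler_peMr//; lra].
have k2 : 0 < kappa ^+ 2 by rewrite exprn_gt0//; lra.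
pose vn := fix vn n := if n is m.+1 then (op (vn m)).1 else fun=> 1 : R.
have cvn n : continuous (vn n).
  by elim: n => [|n IH] /=; [exact: cont_cst|case: (opP _ IH)].
pose un n := (op (vn n)).2.
have step v v' (B S : R) : continuous v -> continuous v' -> 0 <= B ->
    (forall t, 0 < t < S -> `|v t - v' t| <= B * expR (kappa * t)) ->
    forall s, 0 <= s <= S ->
      `|(op v).1 s - (op v').1 s| <= B / 2 * expR (kappa * s).
  move=> cv cv' B0 hB s sS.
  have [cV cU V0 U0 dVU] := opP _ cv; have [cV' cU' V0' U0' dVU'] := opP _ cv'.
  have := @weight_step_exp R w (fun t => (op v).2 t - (op v').2 t)
    (fun t => (op v).1 t - (op v').1 t) (fun t => - f (v t) - - f (v' t)) kappa
    (L * B) 0 S ww (contB cU cU') (contB cV cV') _ _ _ _ _ _ s sS.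
  case => [||||t t0|t tS|_].
  - by rewrite U0 U0' subrr.
  - lra.
  - exact: mulr_ge0.
  - move=> t t0; have [_ d] := dVU _ t0; have [_ d'] := dVU' _ t0.
    apply: der_ext (derB d d'); last by rewrite mulrBr.
    by apply/funext => r; rewrite mulrBr.
  - by have [d _] := dVU _ t0; have [d' _] := dVU' _ t0; exact: derB.
  - have -> : - f (v t) - - f (v' t) = - (f (v t) - f (v' t)) by rewrite opprB addrC opprK.
    rewrite normrN addr0 -mulrA (le_trans (fL _ _))// ler_wpM2l//.
    exact: hB.
  rewrite V0 V0' !subrr subr0 mul0r addr0 => /le_trans; apply.
  rewrite ler_wpM2r ?expR_ge0// ler_pdivrMr//.
  by have := ler_wpM2l B0 kL; lra.
have geo n s : 0 <= s -> `|vn n.+1 s - vn n s| <= expR (kappa * s) / 2 ^+ n.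
  elim: n s => [|n IH] s s0; last first.
    have := step (vn n.+1) (vn n) (1 / 2 ^+ n) s (cvn _) (cvn _) _ _ s.
    rewrite s0 lexx => /(_ _ _ isT) -/(_ _ _)/le_trans; apply.
    - by rewrite divr_ge0.
    - by move=> t /andP[t0 _]; rewrite (le_trans (IH t (ltW t0)))// mul1r mulrC.
    - by rewrite exprS invfM; lra.
  have [cV cU V0 U0 dVU] := opP _ (cvn 0%N).
  have := @weight_step_exp R w (op (vn 0%N)).2 (op (vn 0%N)).1
    (fun t => - f 1) kappa 1 0 s ww cU cV U0 _ _ _ _ _ s.
  rewrite s0 lexx; case => //.
  - lra.
  - by move=> t t0; have [_ d] := dVU _ t0.
  - by move=> t t0; have [d _] := dVU _ t0.
  - move=> t /andP[t0 _]; rewrite normrN addr0 mul1r (le_trans (f1 _))//.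
    by rewrite -expR0 ler_expR mulr_ge0 ?ltW//; lra.
  move=> _; rewrite V0 => /le_trans; apply; rewrite mul0r addr0 expr0 mulrC.
  rewrite ler_wpM2l ?expR_ge0// mul1r invr1 invf_le1//.
  by rewrite -[1](expr1n _ 2) lerXn2r// nnegrE; lra.
have /choice[v vP] : forall s, exists l, forall n,
    `|vn n (Num.max s 0) - l| <= 2 * expR (kappa * Num.max s 0) / 2 ^+ n.
  move=> s.
  apply: (@geo_lim _ (fun n => vn n (Num.max s 0))) => n.
  by apply: geo; rewrite le_max lexx orbT.
have vle n s : 0 <= s -> `|vn n s - v s| <= 2 / 2 ^+ n * expR (kappa * s).
  by move=> s0; have := vP s n; rewrite max_l// => /le_trans; apply; lra.
have ule n s : 0 < s -> `|un n s| <= s.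
  move=> s0; have [cV cU V0 U0 dVU] := opP _ (cvn n).
  rewrite -[leRHS]subr0.
  apply: (@weight_step R w (un n) (fun t => - f (vn n t)) (fun t => t)
    (fun=> 1)) => //.
  - exact: cont_id.
  - exact: ltW.
  - by move=> t t0; have [_] := dVU _ t0.
  - by move=> t _; exact: der_id.
  - by move=> t _; rewrite normrN.
have vlip n S s t : 0 <= s -> s <= t -> t <= S ->
    `|vn n.+1 t - vn n.+1 s| <= S * `|t - s|.
  move=> s0 st tS; have [cV cU V0 U0 dVU] := opP _ (cvn n).
  have -> : `|t - s| = t - s by rewrite ger0_norm// subr_ge0.
  rewrite mulrBr.
  apply: (@der_bound R (vn n.+1) (fun r => S * r) (un n) (fun=> S)) => //.
  - by move=> x /andP[sx _]; have [] := dVU x (le_lt_trans s0 sx).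
  - by move=> x _; have := derZ S (der_id x); rewrite mulr1.
  - by move=> x _; exact: cV.
  - by move=> x _; apply: contZ; exact: cont_id.
  - move=> x /andP[sx xt]; rewrite (le_trans (ule _ _ (le_lt_trans s0 sx)))//.
    by rewrite (le_trans (ltW xt)).
(* The iterates are uniformly Lipschitz on bounded sets, hence so is v. *)
have cv : continuous v.
  move=> x; apply: (@lip_cont _ v x (`|x| + 1)) => y yx.
  pose S := `|x| + 1; pose X := Num.max x 0; pose Y := Num.max y 0.
  have XS : 0 <= X <= S.
    rewrite /X /S; have := ler_norm x; have := normr_ge0 x.
    by case: (leP x 0) => ? ? ?; apply/andP; split=> //; lra.
  have YS : 0 <= Y <= S.
    rewrite /Y /S; have := ler_norm (y - x); have := ler_norm x.
    have := normr_ge0 x.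
    by case: (leP y 0) => ? ? ? ?; apply/andP; split=> //; lra.
  apply: (@geo_le _ _ _ (4 * expR (kappa * S))) => n.
  apply: (@le_trans _ _ (S * `|Y - X| + 4 * expR (kappa * S) / 2 ^+ n)); last first.
    by rewrite lerD2r ler_wpM2l ?max0_dist//; case/andP: XS; exact: le_trans.
  have lip : `|vn n.+1 Y - vn n.+1 X| <= S * `|Y - X|.
    have /andP[X0 XS'] := XS; have /andP[Y0 YS'] := YS.
    have [XY|YX] := leP X Y; first exact: vlip.
    by rewrite distrC [in leRHS]distrC; apply: vlip => //; exact: ltW.
  have err z : Num.max z 0 <= S ->
      `|vn n.+1 (Num.max z 0) - v z| <= 2 * expR (kappa * S) / 2 ^+ n.
    move=> zS; apply: (le_trans (vP z n.+1)).
    apply: ler_pM; rewrite ?mulr_ge0 ?expR_ge0 ?invr_ge0 ?exprn_ge0//.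
      by rewrite ler_pM2l// ler_expR ler_wpM2l//; lra.
    by rewrite lef_pV2 ?posrE ?exprn_gt0// ler_eXn2l// ?ltr1n.
  have eX := err x; have eY := err y.
  move: eX eY; rewrite -/X -/Y => /(_ _)-eX /(_ _)-eY.
  have {}eX := eX (proj2 (andP XS)); have {}eY := eY (proj2 (andP YS)).
  have -> : v y - v x = (vn n.+1 Y - vn n.+1 X) + (vn n.+1 X - v x) - (vn n.+1 Y - v y).
    by ring.
  rewrite (le_trans (ler_normB _ _))//.
  have := ler_normD (vn n.+1 Y - vn n.+1 X) (vn n.+1 X - v x).
  lra.
have [cV cU V0 U0 dVU] := opP _ cv.
have Vv s : 0 <= s -> (op v).1 s = v s.
  move=> s0; apply/eqP; rewrite -subr_eq0 -normr_eq0 eq_le normr_ge0 andbT.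
  apply: (@geo_le _ _ _ (2 * expR (kappa * s))) => n; rewrite add0r.
  have h1 : `|(op v).1 s - vn n.+1 s| <= (2 / 2 ^+ n) / 2 * expR (kappa * s).
    apply: (step v (vn n) _ s) => //.
    - by move=> t /andP[t0 _]; rewrite distrC; apply: vle; exact: ltW.
    - by rewrite s0 lexx.
  have h2 := vle n.+1 _ s0; rewrite exprS invfM in h2.
  have := ler_normD ((op v).1 s - vn n.+1 s) (vn n.+1 s - v s).
  rewrite addrA subrK; lra.
exists (op v).1, (op v).2; split => // s s0.
- by have [] := dVU _ s0.
- by have [_] := dVU _ s0; rewrite Vv ?ltW// mulrN.
Qed.

End Picard.

(** * The rescaled hyperbolic weights *)

(** The profile [sinh (eps s) / eps] of the metric of curvature [- eps ^+ 2],
    with its Euclidean limit [s] at [eps = 0]. *)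
Definition Sf (R : realType) (eps s : R) : R :=
  if eps == 0 then s else sinh (eps * s) / eps.

(** The logarithmic derivative of [Sf eps]: [eps coth (eps s)], or [1 / s]. *)
Definition kf (R : realType) (eps s : R) : R := cosh (eps * s) / Sf eps s.

(** The area density of geodesic spheres in dimension [n.+1]. *)
Definition wt (R : realType) (n : nat) (eps s : R) : R := Sf eps s ^+ n.

Section HyperbolicWeight.
Context {R : realType}.
Implicit Types (x y s t eps : R) (n : nat).

Lemma derV (F : R -> R) x l : F x != 0 -> der F x l ->
  der (fun s => (F s)^-1) x (- (l / F x ^+ 2)).
Proof.
by move=> F0 dF; apply: der_ext (is_deriveV F0 dF) => //;
   rewrite scaleNr; congr (- _); exact: mulrC.
Qed.

Lemma der_expN t : der (fun s : R => expR (- s)) t (- expR (- t)).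
Proof.
apply: der_ext (der_comp (der_exp _) (derN (der_id t))) => //.
by rewrite mulrN1.
Qed.

Lemma der_sinh t : der (@sinh R) t (cosh t).
Proof.
apply: (@der_ext _ (fun s => 2^-1 * (expR s - expR (- s)))).
- by apply/funext => s; rewrite /sinh mulrC.
- exact: erefl.
- apply: der_ext (derZ _ (derB (der_exp t) (der_expN t))) => //.
  by rewrite /cosh opprK mulrC.
Qed.

Lemma der_cosh t : der (@cosh R) t (sinh t).
Proof.
apply: (@der_ext _ (fun s => 2^-1 * (expR s + expR (- s)))).
- by apply/funext => s; rewrite /cosh mulrC.
- exact: erefl.
- apply: der_ext (derZ _ (derD (der_exp t) (der_expN t))) => //.
  by rewrite /sinh mulrC.
Qed.

Lemma sinh0 : sinh (0 : R) = 0.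
Proof. by rewrite /sinh oppr0 subrr mul0r. Qed.

Lemma cosh0 : cosh (0 : R) = 1.
Proof. by rewrite /cosh oppr0 expR0; lra. Qed.

Lemma cosh_ge1 t : 1 <= cosh t.
Proof.
have e0 := expR_gt0 t; have : expR t * expR (- t) = 1 by rewrite expRN divff ?gt_eqF.
by have := sqr_ge0 (expR t - 1); rewrite /cosh; have := expR_gt0 (- t); nra.
Qed.

Lemma der_Sf eps t : der (Sf eps) t (cosh (eps * t)).
Proof.
have [->|e0] := eqVneq eps 0.
  rewrite mul0r cosh0; apply: der_ext (der_id t) => //.
  by apply/funext => s; rewrite /Sf eqxx.
apply: (@der_ext _ (fun s => eps^-1 * sinh (eps * s))).
- by apply/funext => s; rewrite /Sf (negPf e0) mulrC.
- exact: erefl.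
apply: der_ext (derZ _ (der_comp (der_sinh _) (derZ eps (der_id t)))) => //.
by field.
Qed.

Lemma cont_Sf eps : continuous (Sf eps).
Proof. by move=> t; exact: der_cont (der_Sf eps t). Qed.

Lemma Sf0 eps : Sf eps 0 = 0.
Proof. by rewrite /Sf mulr0 sinh0 mul0r; case: ifP. Qed.

Lemma Sf_le eps s t : s <= t -> t - s <= Sf eps t - Sf eps s.
Proof.
move=> st; rewrite -[t - s]ger0_norm ?subr_ge0//.
apply: (@der_bound R (fun t => t) (Sf eps) (fun=> 1)
  (fun t => cosh (eps * t))) => // x _; rewrite ?normr1 ?cosh_ge1//.
- exact: der_id.
- exact: der_Sf.
- exact: cont_Sf.
Qed.

Lemma Sf_ge eps s : 0 <= s -> s <= Sf eps s.
Proof. by move=> /(Sf_le eps); rewrite Sf0 !subr0. Qed.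

Lemma Sf_gt0 eps s : 0 < s -> 0 < Sf eps s.
Proof. by move=> s0; apply: (lt_le_trans s0); apply: Sf_ge; exact: ltW. Qed.

Lemma cont_wt n eps : continuous (wt n eps).
Proof. by apply: contX; exact: cont_Sf. Qed.

Lemma wt_gt0 n eps s : 0 < s -> 0 < wt n eps s.
Proof. by move=> s0; rewrite exprn_gt0// Sf_gt0. Qed.

Lemma weight_wt n eps : (0 < n)%N -> weight (wt n eps).
Proof.
move=> n0; split.
- exact: cont_wt.
- by rewrite /wt Sf0 expr0n; case: n n0.
- by move=> s; exact: wt_gt0.
- move=> s t s0 st; rewrite /wt lerXn2r// ?nnegrE.
  + by rewrite (le_trans s0)// Sf_ge.
  + by rewrite (le_trans (le_trans s0 st))// Sf_ge// (le_trans s0).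
  + by have := Sf_le eps st; lra.
Qed.

Lemma der_wt n eps s : 0 < s ->
  der (wt n eps) s (n%:R * kf eps s * wt n eps s).
Proof.
move=> s0; apply: der_ext (derX n (der_Sf eps s)) => //.
have S0 : Sf eps s != 0 by rewrite gt_eqF// Sf_gt0.
by case: n => [|n]; rewrite ?mul0r// /wt /kf exprS/=; field.
Qed.

(** Monotonicity of the chord slopes, issued from 0, of [expR x - 1] and
    [1 - expR (- x)]. *)
Lemma expR_chord x y : 0 < x -> x <= y ->
  y * (expR x - 1) <= x * (expR y - 1) /\
  x * (1 - expR (- y)) <= y * (1 - expR (- x)).
Proof.
move=> x0 xy; have ex0 := expR_gt0 x; have emx0 := expR_gt0 (- x).
have eN : expR x * expR (- x) = 1 by rewrite expRN divff ?gt_eqF.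
have e1 := expR_ge1Dx x; have e2 := expR_ge1Dx (- x).
split.
  suff : - (x * (expR y - 1) - y * (expR x - 1)) <=
      - (x * (expR x - 1) - x * (expR x - 1)) by lra.
  apply: (@nincr_le R (fun t => - (x * (expR t - 1) - t * (expR x - 1)))
    (fun t => - (x * expR t - (expR x - 1)))) => // t xt.
  - apply: der_ext (derN (derB (derZ x (derB (der_exp t) (der_cst 1 t)))
      (derM (der_id t) (der_cst (expR x - 1) t)))) => //.
    by ring.
  - apply: contN; apply: contB.
      by apply: contZ; apply: contB; [exact: continuous_expR|exact: cont_cst].
    by apply: contM; [exact: cont_id|exact: cont_cst].
  - have : expR x <= expR t by rewrite ler_expR; lra.
    by move=> ext; nra.
suff : - (y * (1 - expR (- x)) - x * (1 - expR (- y))) <=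
    - (x * (1 - expR (- x)) - x * (1 - expR (- x))) by lra.
apply: (@nincr_le R (fun t => - (t * (1 - expR (- x)) - x * (1 - expR (- t))))
  (fun t => - ((1 - expR (- x)) - x * expR (- t)))) => // t xt.
- apply: der_ext (derN (derB (derM (der_id t) (der_cst (1 - expR (- x)) t))
    (derZ x (derB (der_cst 1 t) (der_expN t))))) => //.
  by ring.
- apply: contN; apply: contB.
    by apply: contM; [exact: cont_id|exact: cont_cst].
  apply: contZ; apply: contB; first exact: cont_cst.
  by apply: (cont_comp (@continuous_expR R)); apply: contN; exact: cont_id.
- have : expR (- t) <= expR (- x) by rewrite ler_expR; lra.
  by move=> ext; nra.
Qed.

(* eps coth (eps s) = eps + q (2 eps s) / s, see kfE below. *)
Let q y := if y == 0 then 1 else y / (expR y - 1).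

Let q_mono x y : 0 <= x -> x <= y -> q y <= q x /\ q x + x <= q y + y.
Proof.
have pos (z : R) : 0 < z -> 0 < expR z - 1.
  by move=> z0; rewrite subr_gt0 expR_gt1.
move=> x0; rewrite le_eqVlt => /predU1P[<-//|xy].
have y0 := le_lt_trans x0 xy; have py := pos _ y0.
rewrite /q (gt_eqF y0).
have Ny : expR y * expR (- y) = 1 by rewrite expRN divff// gt_eqF// expR_gt0.
have ey := expR_gt0 y.
move: x0; rewrite le_eqVlt => /predU1P[<-|x0].
  rewrite eqxx addr0; split.
    by rewrite ler_pdivrMr// mul1r; have := expR_ge1Dx y; lra.
  have -> : y / (expR y - 1) + y = y * expR y / (expR y - 1) by field; rewrite gt_eqF.
  by rewrite ler_pdivlMr// mul1r; have := expR_ge1Dx (- y); nra.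
have px := pos _ x0; rewrite (gt_eqF x0).
have Nx : expR x * expR (- x) = 1 by rewrite expRN divff// gt_eqF// expR_gt0.
have ex := expR_gt0 x.
have [c1 c2] := expR_chord x0 (ltW xy); split.
  by rewrite ler_pdivrMr// mulrAC ler_pdivlMr.
have -> : y / (expR y - 1) + y = y * expR y / (expR y - 1) by field; rewrite gt_eqF.
have -> : x / (expR x - 1) + x = x * expR x / (expR x - 1) by field; rewrite gt_eqF.
rewrite ler_pdivrMr// mulrAC ler_pdivlMr//.
have := ler_wpM2l (ltW (mulr_gt0 ex ey)) c2.
have -> : expR x * expR y * (x * (1 - expR (- y))) =
  x * expR x * (expR y - expR y * expR (- y)) by ring.
have -> : expR x * expR y * (y * (1 - expR (- x))) =
  y * expR y * (expR x - expR x * expR (- x)) by ring.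
by rewrite Nx Ny.
Qed.

Let kfE eps s : 0 <= eps -> 0 < s -> kf eps s = eps + q (2 * eps * s) / s.
Proof.
move=> e0 s0; rewrite /kf /Sf /q.
have [->|en0] := eqVneq eps 0.
  by rewrite mulr0 !mul0r eqxx cosh0 add0r.
have ep : 0 < eps by rewrite lt_def en0.
rewrite gt_eqF; last by rewrite !mulr_gt0.
have -> : 2 * eps * s = eps * s + eps * s by ring.
have eN : expR (- (eps * s)) = (expR (eps * s))^-1 by rewrite expRN.
rewrite expRD /cosh /sinh eN.
have a1 : 1 < expR (eps * s) by rewrite expR_gt1 mulr_gt0.
set a := expR (eps * s) in a1 *.
have a0 : a != 0 by rewrite gt_eqF//; lra.
have aa : a * a - 1 != 0 by rewrite gt_eqF//; nra.
by field; rewrite en0 gt_eqF//= aa a0.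
Qed.

(** [eps coth (eps s)] is 1-Lipschitz in [eps], uniformly in [s], since [q] is
    nonincreasing and [q y + y] is nondecreasing. *)
Lemma kf_lip eps eps' s : 0 <= eps -> 0 <= eps' -> 0 < s ->
  `|kf eps s - kf eps' s| <= `|eps - eps'|.
Proof.
move=> e0 e0' s0.
wlog le : eps eps' e0 e0' / eps <= eps'.
  move=> H; have [|/ltW] := leP eps eps'; first exact: H.
  by move=> le; rewrite distrC [leRHS]distrC; exact: H.
rewrite [leRHS]distrC [`|eps' - _|]ger0_norm ?subr_ge0//.
have l1 : 0 <= 2 * eps * s by rewrite !mulr_ge0// ltW.
have l2 : 2 * eps * s <= 2 * eps' * s by rewrite ler_pM2r// ler_pM2l.
have [q1 q2] := q_mono l1 l2; rewrite !kfE//.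
have i1 : q (2 * eps' * s) / s <= q (2 * eps * s) / s by rewrite ler_pM2r ?invr_gt0.
have : (q (2 * eps * s) + 2 * eps * s) / s <= (q (2 * eps' * s) + 2 * eps' * s) / s.
  by rewrite ler_pM2r ?invr_gt0.
by rewrite ![(_ + _) / s]mulrDl !mulfK ?gt_eqF// ler_norml; lra.
Qed.

Lemma kf_le eps s : 0 <= eps -> 0 < s -> kf eps s <= s^-1 + eps.
Proof.
move=> e0 s0; have := kf_lip e0 (lexx 0) s0.
rewrite subr0 [X in _ <= X]ger0_norm//.
have -> : kf 0 s = s^-1 by rewrite /kf /Sf eqxx mul0r cosh0 mul1r.
by rewrite ler_norml; lra.
Qed.

Lemma kf_gt0 eps s : 0 < s -> 0 < kf eps s.
Proof.
by move=> s0; rewrite divr_gt0 ?Sf_gt0// (lt_le_trans ltr01)// cosh_ge1.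
Qed.

End HyperbolicWeight.

(** * The rescaled family of initial value problems *)

(** Truncation to the unit interval, where the solutions of interest live. *)
Definition clamp (R : realType) (x : R) : R := Num.min (Num.max x 0) 1.

(** The nonlinearity [x ^ (p + 1) - mu x], truncated to make it bounded and
    globally Lipschitz. *)
Definition nonlin (R : realType) (p mu x : R) : R :=
  clamp x `^ (p + 1) - mu * clamp x.

(** If [phi] is a radial solution of the stationary equation and
    [phi 0 = eps `^ (- 2 / p)], then [v s = phi (eps s) / phi 0] solves this
    problem, which makes sense also for [eps = 0]. *)
Definition fam (R : realType) (n : nat) (lam p eps : R) (v u : R -> R) : Prop :=
  radsol (wt n eps) (nonlin p (lam * eps ^+ 2)) v u.

Section Family.
Context {R : realType}.
Implicit Types (x y s t eps mu : R).

Lemma min_max_lip (a x y : R) : 0 <= a ->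
  `|Num.min (Num.max x 0) a - Num.min (Num.max y 0) a| <= `|x - y|.
Proof.
move=> a0.
have := ler_norm (x - y); have := ler_norm (y - x); rewrite distrC => h1 h2.
case: (leP x 0) => ?; case: (leP y 0) => ?.
- by rewrite subrr normr0.
- by rewrite (min_l a0); case: (leP y a) => ?; rewrite ler_norml; lra.
- by rewrite (min_l a0); case: (leP x a) => ?; rewrite ler_norml; lra.
- by case: (leP x a) => ?; case: (leP y a) => ?; rewrite ler_norml; lra.
Qed.

Lemma clampP x : 0 <= clamp x <= 1.
Proof.
by rewrite /clamp le_min ge_min le_max !lexx !orbT ler01.
Qed.

Lemma clamp_id x : 0 <= x <= 1 -> clamp x = x.
Proof. by move=> /andP[x0 x1]; rewrite /clamp max_l// min_l. Qed.

Lemma clamp_le0 x : x <= 0 -> clamp x = 0.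
Proof. by move=> x0; rewrite /clamp max_r// min_l. Qed.

Lemma clamp_lip x y : `|clamp x - clamp y| <= `|x - y|.
Proof. exact: min_max_lip ler01. Qed.

Lemma der_powR q x : 0 < x -> der (fun t => t `^ q) x (q * x `^ (q - 1)).
Proof. by move=> x0; exact: is_derive1_powR. Qed.

Lemma powR_lip q x y : 1 <= q -> 0 <= x <= 1 -> 0 <= y <= 1 ->
  `|x `^ q - y `^ q| <= q * `|x - y|.
Proof.
move=> q1; wlog xy : x y / y <= x.
  move=> H h1 h2; have [yx|/ltW xy] := leP y x; first exact: H.
  by rewrite distrC [in leRHS]distrC; exact: H.
move=> /andP[x0 x1] /andP[]; rewrite le_eqVlt => /predU1P[<- _|y0 y1].
  rewrite powR0 ?gt_eqF ?(lt_le_trans ltr01)// !subr0 !ger0_norm ?powR_ge0//.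
  move: x0; rewrite le_eqVlt => /predU1P[<-|x0].
    by rewrite powR0 ?mulr0// gt_eqF// (lt_le_trans ltr01).
  have : x `^ q <= x by apply: ge1r_powR => //; rewrite x0.
  by move=> /le_trans; apply; rewrite ler_peMl// ltW.
rewrite [X in _ <= _ * X]ger0_norm ?subr_ge0// mulrBr.
apply: (@der_bound R (fun t => t `^ q) (fun t => q * t)
  (fun t => q * t `^ (q - 1)) (fun=> q)) => // t /andP[yt tx].
- by apply: der_powR; exact: lt_trans y0 yt.
- by have := derZ q (der_id t); rewrite mulr1.
- exact: der_cont (der_powR q (lt_le_trans y0 yt)).
- by apply: contZ; exact: cont_id.
- have t0 := lt_trans y0 yt; have q0 : 0 <= q by lra.
  rewrite normrM (ger0_norm q0) ger0_norm ?powR_ge0// ler_piMr//.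
  rewrite -[leRHS](powRr0 t).
  by apply: ger_powR; [rewrite t0 ltW// (lt_le_trans tx)|lra].
Qed.

Section Nonlinearity.
Variables (p : R).
Hypothesis p0 : 0 < p.

Lemma nonlin_lip mu mu' x y : 0 <= mu <= 1 ->
  `|nonlin p mu x - nonlin p mu' y| <= (p + 2) * `|x - y| + `|mu - mu'|.
Proof.
move=> /andP[m0 m1]; rewrite /nonlin.
have -> : clamp x `^ (p + 1) - mu * clamp x - (clamp y `^ (p + 1) - mu' * clamp y) =
   (clamp x `^ (p + 1) - clamp y `^ (p + 1)) - mu * (clamp x - clamp y)
   - (mu - mu') * clamp y by ring.
rewrite (le_trans (ler_normB _ _))// lerD//; last first.
  rewrite normrM ler_piMr//; have /andP[c0 c1] := clampP y.
  by rewrite ger0_norm.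
have pp := p0; have p1 : 1 <= p + 1 by lra.
rewrite (le_trans (ler_normB _ _))//.
have h1 := powR_lip p1 (clampP x) (clampP y).
have h2 := clamp_lip x y.
have h3 : `|mu * (clamp x - clamp y)| <= `|x - y|.
  by rewrite normrM ger0_norm// (le_trans _ h2)// ler_piMl.
have h4 : (p + 1) * `|clamp x - clamp y| <= (p + 1) * `|x - y|.
  by rewrite ler_wpM2l//; lra.
by lra.
Qed.

Lemma nonlin_lip1 mu x y : 0 <= mu <= 1 ->
  `|nonlin p mu x - nonlin p mu y| <= (p + 2) * `|x - y|.
Proof. by move=> m; have := nonlin_lip mu x y m; rewrite subrr normr0 addr0. Qed.

Lemma nonlin_le1 mu x : 0 <= mu <= 1 -> `|nonlin p mu x| <= 1.
Proof.
move=> /andP[m0 m1]; have pp := p0; rewrite /nonlin; have /andP[c0 c1] := clampP x.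
have h1 : 0 <= clamp x `^ (p + 1) <= 1.
  rewrite powR_ge0/=; have : clamp x `^ (p + 1) <= 1 `^ (p + 1).
    by apply: ge0_ler_powR; rewrite ?nnegrE//; lra.
  by rewrite powR1.
have h2 : 0 <= mu * clamp x <= 1.
  by rewrite mulr_ge0//= -[1](mulr1 1) ler_pM.
by rewrite ler_norml; lra.
Qed.

Lemma cont_nonlin mu : 0 <= mu <= 1 -> continuous (nonlin p mu).
Proof.
by move=> m; apply: (@lipschitz_continuous _ _ (p + 2)) => x y; exact: nonlin_lip1.
Qed.

Lemma nonlin_le0 mu x : x <= 0 -> nonlin p mu x = 0.
Proof.
by move=> x0; have pp := p0; rewrite /nonlin clamp_le0// powR0 ?mulr0 ?subrr// gt_eqF//; lra.
Qed.

Lemma nonlinE mu x : 0 <= x <= 1 -> nonlin p mu x = x `^ (p + 1) - mu * x.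
Proof. by move=> x01; rewrite /nonlin clamp_id. Qed.

Lemma powRS x : 0 <= x -> x `^ (p + 1) = x * x `^ p.
Proof. by move=> x0; have pp := p0; rewrite -(mulr_powRB1 x0); [rewrite addrK|lra]. Qed.

End Nonlinearity.

Section Solutions.
Variables (n : nat) (lam p e1 : R).
Hypotheses (n0 : (0 < n)%N) (lam0 : 0 < lam) (p0 : 0 < p) (e10 : 0 <= e1).
Hypothesis (le1 : lam * e1 ^+ 2 <= 1).

Lemma mu_itv eps : 0 <= eps <= e1 -> 0 <= lam * eps ^+ 2 <= 1.
Proof.
move=> /andP[h0 h1]; apply/andP; split.
  by rewrite mulr_ge0 ?sqr_ge0// ltW.
by apply: le_trans le1; rewrite ler_pM2l// lerXn2r.
Qed.

Lemma fam_exists eps : 0 <= eps <= e1 -> exists v u, fam n lam p eps v u.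
Proof.
move=> he; apply: (@radsol_exists _ _ _ (p + 2)); first exact: weight_wt.
- by move=> x; apply: nonlin_le1 => //; exact: mu_itv.
- by move=> x y; apply: nonlin_lip1 => //; exact: mu_itv.
Qed.

Lemma fam_u_le eps v u s : 0 <= eps <= e1 -> fam n lam p eps v u -> 0 <= s ->
  `|u s| <= s.
Proof.
move=> he [cv cu v0 u0 dv du] s0; rewrite -[leRHS]subr0.
apply: (@weight_step _ (wt n eps) u (fun t => - nonlin p (lam * eps ^+ 2) (v t))
   (fun t => t) (fun=> 1)) => //.
- exact: weight_wt.
- exact: cont_id.
- by move=> t t0; rewrite mulrN; exact: du.
- by move=> t _; exact: der_id.
- by move=> t _; rewrite normrN nonlin_le1// mu_itv.
Qed.

Lemma fam_v_le eps v u s : 0 <= eps <= e1 -> fam n lam p eps v u -> 0 <= s ->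
  `|v s - 1| <= s ^+ 2 / 2.
Proof.
move=> he vu s0; have [cv cu v0 u0 dv du] := vu.
have -> : s ^+ 2 / 2 = s ^+ 2 / 2 - 0 ^+ 2 / 2 by rewrite expr0n/= mul0r subr0.
have -> : v s - 1 = v s - v 0 by rewrite v0.
apply: (@der_bound R v (fun t => t ^+ 2 / 2) u (fun t => t)) => // t.
- by move=> /andP[t0 _]; exact: dv.
- move=> _; apply: (@der_ext _ (fun t => 2^-1 * t ^+ 2)).
  + by apply/funext => r; rewrite mulrC.
  + exact: erefl.
  + by apply: der_ext (derZ _ (derX 2 (der_id t))) => //; rewrite expr1; field.
- by move=> _; exact: cv.
- by move=> _; apply: contM; [apply: contX; exact: cont_id|exact: cont_cst].
- by move=> /andP[t0 ts]; apply: fam_u_le vu _ => //; exact: ltW.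
Qed.

(** The second-order form of the equation. *)
Lemma fam_der_u eps v u s : fam n lam p eps v u -> 0 < s ->
  der u s (- (n%:R * kf eps s * u s) - nonlin p (lam * eps ^+ 2) (v s)).
Proof.
move=> [cv cu v0 u0 dv du] s0.
have w0 : wt n eps s != 0 by rewrite gt_eqF// wt_gt0.
have d := derM (du s s0) (derV w0 (der_wt n eps s0)).
apply: (@der_near _ (fun t => wt n eps t * u t * (wt n eps t)^-1)).
  near=> t; rewrite mulrAC mulfV ?mul1r// gt_eqF// wt_gt0//.
  by near: t; exact: lt_nbhsr.
by apply: der_ext d => //; field.
Unshelve. all: by end_near. Qed.

(** Lipschitz dependence on [eps], by bootstrapping [weight_step_exp] on the
    difference of two solutions.  With [eps = eps'] this is uniqueness. *)
Lemma fam_dependence S : 0 <= S -> exists C, forall eps eps' v u v' u',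
  0 <= eps <= e1 -> 0 <= eps' <= e1 ->
  fam n lam p eps v u -> fam n lam p eps' v' u' ->
  forall s, 0 <= s <= S -> `|v s - v' s| <= C * `|eps - eps'| /\
    `|u s - u' s| <= C * `|eps - eps'|.
Proof.
move=> S0; pose L := p + 2; pose kappa := 2 * L + 1.
have pp := p0; have L0 : 0 < L by rewrite /L; lra.
have k1 : 1 <= kappa by rewrite /kappa; lra.
have k0 : 0 < kappa by lra.
have kL : 2 * L <= kappa ^+ 2.
  by apply: (@le_trans _ _ kappa); [rewrite /kappa; lra|rewrite expr2 ler_peMr//; lra].
have k2 : 0 < kappa ^+ 2 by rewrite exprn_gt0.
pose K := 2 * lam * e1 + n%:R * S.
have K0 : 0 <= K by rewrite /K addr_ge0// !mulr_ge0// ltW.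
pose Cv := K * S ^+ 2 * expR (kappa * S).
pose Cu := L * K * S ^+ 2 / kappa * expR (kappa * S) + K * S.
have Cv0 : 0 <= Cv by rewrite !mulr_ge0 ?expR_ge0// exprn_ge0.
have Cu0 : 0 <= Cu.
  by rewrite addr_ge0 ?mulr_ge0 ?expR_ge0 ?invr_ge0 ?exprn_ge0// ltW.
exists (Cv + Cu) => eps eps' v u v' u' he he' vu vu'.
have [cv cu v0 u0 dv du] := vu; have [cv' cu' v0' u0' dv' du'] := vu'.
set D := `|eps - eps'|; pose eta := K * D.
have D0 : 0 <= D by exact: normr_ge0.
have eta0 : 0 <= eta by rewrite mulr_ge0.
pose h t := - nonlin p (lam * eps ^+ 2) (v t) + nonlin p (lam * eps' ^+ 2) (v' t)
  + n%:R * (kf eps' t - kf eps t) * u' t.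
have dU t : 0 < t -> der (fun r => wt n eps r * (u r - u' r)) t (wt n eps t * h t).
  move=> t0; have d1 := du t t0.
  have d2 := derM (der_wt n eps t0) (fam_der_u vu' t0).
  apply: der_ext (derB d1 d2); first by apply/funext => r; rewrite mulrBr.
  by rewrite /h; ring.
have dV t : 0 < t -> der (fun r => v r - v' r) t (u t - u' t).
  by move=> t0; apply: derB; [exact: dv|exact: dv'].
have step B : 0 <= B -> (forall t, 0 < t < S -> `|v t - v' t| <= B * expR (kappa * t)) ->
    forall s, 0 <= s <= S ->
    `|u s - u' s| <= L * B / kappa * expR (kappa * s) + eta * s /\
    `|v s - v' s| <= (B / 2 + eta * (S ^+ 2 / 2)) * expR (kappa * s).
  move=> B0 hB s sS.
  have := @weight_step_exp R (wt n eps) (fun t => u t - u' t)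
    (fun t => v t - v' t) h kappa (L * B) eta S (weight_wt eps n0) (contB cu cu') (contB cv cv')
    _ k0 _ dU dV _ s sS.
  case => [|||hu hv].
  - by rewrite u0 u0' subrr.
  - by rewrite mulr_ge0// ltW.
  - move=> t /andP[t0 tS].
    have h1 := nonlin_lip p0 (lam * eps' ^+ 2) (v t) (v' t) (mu_itv he).
    have h2 : `|lam * eps ^+ 2 - lam * eps' ^+ 2| <= 2 * lam * e1 * D.
      rewrite -mulrBr subr_sqr mulrCA normrM [leRHS]mulrC ler_wpM2l//.
      rewrite normrM gtr0_norm// -mulrA mulrCA ler_pM2l//.
      by rewrite ger0_norm; have := e10; lra.
    have h3 : `|n%:R * (kf eps' t - kf eps t) * u' t| <= n%:R * S * D.
      rewrite !normrM normr_nat -!mulrA ler_wpM2l// mulrC ler_pM//.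
        by rewrite (le_trans (fam_u_le he' vu' (ltW t0)))// ltW.
      by rewrite distrC; apply: kf_lip => //; [case/andP: he|case/andP: he'].
    have h4 := hB t; rewrite t0 tS in h4; have {}h4 := h4 isT.
    have h5 : L * `|v t - v' t| <= L * (B * expR (kappa * t)) by rewrite ler_pM2l.
    have hE : h t = - (nonlin p (lam * eps ^+ 2) (v t) - nonlin p (lam * eps' ^+ 2) (v' t))
      + n%:R * (kf eps' t - kf eps t) * u' t by rewrite /h; ring.
    rewrite hE (le_trans (ler_normD _ _))// normrN.
    rewrite /eta /K -/L in h1 *; lra.
  split => //; move: hv; rewrite v0 v0' subrr subr0 => /le_trans; apply.
  have /andP[s0 sS'] := sS.
  have e1s : 1 <= expR (kappa * s) by rewrite -expR0 ler_expR mulr_ge0// ltW.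
  have i1 : L * B / kappa ^+ 2 <= B / 2.
    by rewrite ler_pdivrMr//; have := ler_wpM2l B0 kL; lra.
  have i2 : eta * (s ^+ 2 / 2) <= eta * (S ^+ 2 / 2).
    by rewrite ler_wpM2l// ler_pM2r ?invr_gt0// lerXn2r.
  have i3 : eta * (S ^+ 2 / 2) <= eta * (S ^+ 2 / 2) * expR (kappa * s).
    by rewrite ler_peMr// mulr_ge0// divr_ge0// exprn_ge0.
  have i4 : L * B / kappa ^+ 2 * expR (kappa * s) <= B / 2 * expR (kappa * s).
    by rewrite ler_wpM2r// expR_ge0.
  by lra.
have iter m t : 0 <= t <= S ->
    `|v t - v' t| <= (S ^+ 2 / 2 ^+ m + eta * S ^+ 2) * expR (kappa * t).
  elim: m t => [|m IH] t tS.
    have /andP[t0 tS'] := tS.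
    have h1 := fam_v_le he vu t0; have h2 := fam_v_le he' vu' t0.
    have -> : v t - v' t = (v t - 1) - (v' t - 1) by ring.
    rewrite (le_trans (ler_normB _ _))// expr0 divr1.
    have e1t : 1 <= expR (kappa * t) by rewrite -expR0 ler_expR mulr_ge0// ltW.
    apply: (@le_trans _ _ (S ^+ 2 + eta * S ^+ 2)); last first.
      by rewrite ler_peMr// addr_ge0// ?mulr_ge0// exprn_ge0.
    have : t ^+ 2 <= S ^+ 2 by rewrite lerXn2r.
    have : 0 <= eta * S ^+ 2 by rewrite mulr_ge0// exprn_ge0.
    by lra.
  have [||_ hv] := step (S ^+ 2 / 2 ^+ m + eta * S ^+ 2) _ _ t tS.
  - by rewrite addr_ge0// ?mulr_ge0 ?invr_ge0// exprn_ge0.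
  - by move=> r /andP[r0 rS]; apply: IH; rewrite !ltW.
  by move: hv; rewrite [2 ^+ m.+1]exprS invfM; lra.
have lim t : 0 <= t <= S -> `|v t - v' t| <= eta * S ^+ 2 * expR (kappa * t).
  move=> tS; apply: (@geo_le _ _ _ (S ^+ 2 * expR (kappa * t))) => m.
  by have := iter m t tS; lra.
move=> s sS; have /andP[s0 sS'] := sS.
have B0 : 0 <= eta * S ^+ 2 by rewrite mulr_ge0// exprn_ge0.
have [|hu _] := step _ B0 _ s sS.
  by move=> t /andP[t0 tS]; apply: lim; rewrite !ltW.
have es : expR (kappa * s) <= expR (kappa * S) by rewrite ler_expR ler_pM2l.
split.
  apply: (le_trans (lim s sS)); apply: (@le_trans _ _ (Cv * D)).
    have := ler_wpM2l B0 es; rewrite /Cv /eta; lra.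
  by rewrite ler_wpM2r// lerDl.
apply: (le_trans hu); apply: (@le_trans _ _ (Cu * D)); last first.
  by rewrite ler_wpM2r// lerDr.
have B1 : 0 <= L * (eta * S ^+ 2) / kappa by rewrite divr_ge0// ?mulr_ge0// ltW.
have := ler_wpM2l B1 es; have := ler_wpM2l eta0 sS'.
by rewrite /Cu /eta; lra.
Qed.

End Solutions.
End Family.

(** * Energy and monotonicity *)

Section Energy.
Context {R : realType}.
Implicit Types (x y s t eps mu : R).

(** Antiderivatives of the two terms of the nonlinearity.  They do not depend
    on [mu], so that the energy is visibly continuous in [mu]. *)
Lemma potentials (p : R) : 0 < p -> exists G Q : R -> R,
  [/\ continuous G, continuous Q, G 0 = 0, Q 0 = 0 &
   forall mu, [/\ forall x, 0 < x -> der (fun t => G t - mu * Q t) x (nonlin p mu x)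
    & forall x, 0 <= x <= 1 ->
      G x - mu * Q x = x ^+ 2 * (x `^ p / (p + 2) - mu / 2)]].
Proof.
move=> p0; have p2 : p + 2 != 0 by rewrite gt_eqF//; lra.
have h0 : 0 <= (0 : R) <= 1 by rewrite lexx ler01.
have cg : continuous (fun x : R => clamp x `^ (p + 1)).
  have -> : (fun x : R => clamp x `^ (p + 1)) = nonlin p 0.
    by apply/funext => x; rewrite /nonlin mul0r subr0.
  exact: cont_nonlin.
have cc : continuous (@clamp R).
  by apply: (@lipschitz_continuous _ _ 1) => x y; rewrite mul1r clamp_lip.
have [G [cG G0 dG]] := primitive cg; have [Q [cQ Q0 dQ]] := primitive cc.
exists G, Q; split => // mu.
have dF x : 0 < x -> der (fun t => G t - mu * Q t) x (nonlin p mu x).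
  by move=> x0; apply: derB; [exact: dG|apply: derZ; exact: dQ].
split => // x /andP[x0 x1].
pose H t := (t * t `^ (p + 1)) / (p + 2) - mu / 2 * t ^+ 2.
have dH t : 0 < t -> der H t (t `^ (p + 1) - mu * t).
  move=> t0; apply: (@der_ext _ (fun t => (p + 2)^-1 * (t * t `^ (p + 1)) - mu / 2 * t ^+ 2)).
  - by apply/funext => r; rewrite /H mulrC.
  - exact: erefl.
  apply: der_ext (derB (derZ _ (derM (der_id t) (der_powR (p + 1) t0)))
    (derZ _ (derX 2 (der_id t)))) => //.
  have -> : t `^ (p + 1) = t * t `^ p by rewrite powRS// ltW.
  by rewrite addrK /=; field.
have cH t : 0 <= t -> {for t, continuous H}.
  rewrite le_eqVlt => /predU1P[<-|t0]; last exact: der_cont (dH t t0).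
  have c1 : {for 0, continuous (fun t : R => t * t `^ (p + 1))}.
    apply: (@lip_cont _ _ 0 1) => y; rewrite subr0 mul0r subr0 mul1r => y1.
    rewrite normrM ler_piMr//; have [y0|y0] := ltP y 0; first by rewrite lt0_powR1// normr1.
    rewrite ger0_norm ?powR_ge0//; have : y `^ (p + 1) <= 1 `^ (p + 1).
      by apply: ge0_ler_powR; rewrite ?nnegrE//; move: y1; rewrite ?ger0_norm//; lra.
    by rewrite powR1.
  apply: continuousB; first by apply: continuousM => //; exact: cont_cst.
  by apply: contZ; apply: contX; exact: cont_id.
have H0 : H 0 = 0 by rewrite /H expr0n/= !(mul0r, mulr0) subr0.
have : `|((G x - mu * Q x) - H x) - ((G 0 - mu * Q 0) - H 0)| <= 0 * x - 0 * 0.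
  apply: (@der_bound R (fun x => (G x - mu * Q x) - H x) (fun x => 0 * x)
    (fun t => nonlin p mu t - (t `^ (p + 1) - mu * t)) (fun=> 0)) => // t.
  - by move=> /andP[t0 tx]; apply: derB; [exact: dF|exact: dH].
  - by move=> _; have := derZ 0 (der_id t); rewrite mul0r.
  - move=> /andP[t0 tx]; apply: continuousB; last exact: cH.
    by apply: contB => //; exact: contZ.
  - by move=> _; apply: contZ; exact: cont_id.
  - move=> /andP[t0 tx]; rewrite nonlinE; first by rewrite subrr normr0.
    by rewrite ltW//= (le_trans (ltW tx)).
rewrite G0 Q0 H0 !(mul0r, mulr0, subr0) normr_le0 subr_eq0 => /eqP ->.
by rewrite /H powRS//; field.
Qed.

End Energy.

Section Qualitative.
Context {R : realType}.
Implicit Types (x y s t eps mu : R).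
Variables (n : nat) (lam p e1 : R).
Hypotheses (n0 : (0 < n)%N) (lam0 : 0 < lam) (p0 : 0 < p) (e10 : 0 <= e1).
Hypothesis (le1 : lam * e1 ^+ 2 < 1).
Variables (eps : R) (v u : R -> R).
Hypotheses (he : 0 <= eps <= e1) (vu : fam n lam p eps v u).

Local Notation mu := (lam * eps ^+ 2).
Local Notation f := (nonlin p mu).

Let hmu : 0 <= mu <= 1 := mu_itv lam0 e10 (ltW le1) he.

Let mu1 : mu < 1.
Proof.
have /andP[h0 h1] := he; apply: le_lt_trans le1; rewrite ler_pM2l//.
by rewrite lerXn2r.
Qed.

Let cv : continuous v := radsol_contv vu.
Let cu : continuous u := radsol_contu vu.
Let cfv : continuous (fun s => f (v s)).
Proof. by apply: (@cont_comp _ f v); [exact: cont_nonlin|exact: cv]. Qed.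

(** The flux [w u] decreases where the nonlinearity is positive. *)
Lemma flux_decr a b : 0 <= a -> a < b -> (forall t, a < t < b -> 0 < f (v t)) ->
  wt n eps b * u b < wt n eps a * u a.
Proof.
move=> a0 ab fpos.
apply: (@decr_lt R (fun t => wt n eps t * u t)
  (fun t => - (wt n eps t * f (v t)))) => // t.
- by move=> /andP[at_ _]; apply: (radsol_deru vu); exact: le_lt_trans at_.
- by move=> _; apply: contM => //; exact: cont_wt.
- move=> /andP[at_ tb]; rewrite oppr_lt0 mulr_gt0 ?fpos ?at_//.
  by rewrite wt_gt0// (le_lt_trans a0).
Qed.

Lemma u_neg_near0 : exists2 s0, 0 < s0 & forall s, 0 < s <= s0 -> u s < 0.
Proof.
have f1 : 0 < f (v 0).
  rewrite (radsol_v0 vu) nonlinE ?ler01 ?lexx// powR1 mulr1.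
  by have := mu1; lra.
have /nbhs_ballP[d /= d0 Hd] : \forall x \near (0 : R), 0 < f (v x).
  exact: (@cvgr_gt _ _ _ _ (fun s => f (v s)) _ (@cfv 0)).
exists (d / 2); first by rewrite divr_gt0.
move=> s /andP[s0 sd].
have : wt n eps s * u s < wt n eps 0 * u 0.
  apply: flux_decr => // t /andP[t0 ts]; apply: Hd.
  by rewrite /ball/= sub0r normrN gtr0_norm//; lra.
by rewrite (radsol_u0 vu) mulr0 pmulr_rlt0// wt_gt0.
Qed.

Lemma v_decr a b : 0 <= a -> a < b -> (forall t, a < t < b -> u t < 0) -> v b < v a.
Proof.
move=> a0 ab un; apply: (@decr_lt R v u) => // t.
- by move=> /andP[at_ _]; apply: (radsol_derv vu); exact: le_lt_trans at_.
- by move=> _; exact: cv.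
Qed.

(** Backward uniqueness: the solution has no double zero. *)
Lemma no_double_zero z a : 0 < a -> a < z -> v z = 0 -> u z = 0 -> u a = 0.
Proof.
move=> a0 az vz uz.
pose K := 2 * n%:R * (a^-1 + eps) + (p + 2) + 1.
pose q t := u t ^+ 2 + v t ^+ 2.
have dq t : a < t -> der (fun t => - (q t * expR (K * t))) t
  (- (q t * (K * expR (K * t)) + (2 * u t * (- (n%:R * kf eps t * u t) - f (v t))
     + 2 * v t * u t) * expR (K * t))).
  move=> at_; have t0 := lt_trans a0 at_; apply: derN.
  have d := derM (derD (derX 2 (fam_der_u vu t0)) (derX 2 (radsol_derv vu t0)))
    (der_expZ K t).
  by apply: (der_ext _ _ d) => //; rewrite !expr1 /q; ring.
have : - (q z * expR (K * z)) <= - (q a * expR (K * a)).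
  apply: (@nincr_le R (fun t => - (q t * expR (K * t))) (fun t =>
    - (q t * (K * expR (K * t)) + (2 * u t * (- (n%:R * kf eps t * u t) - f (v t))
     + 2 * v t * u t) * expR (K * t))) a z (ltW az)) => [t /andP[at_ _]|t _|t /andP[at_ tz]].
  - exact: dq at_.
  - apply: contN; apply: contM; last exact: cont_expZ.
    by apply: contD; exact: contX.
  - have t0 := lt_trans a0 at_.
    rewrite oppr_le0.
    have dist (A B e : R) : A * (K * e) + B * e = (K * A + B) * e by ring.
    rewrite dist.
    rewrite mulr_ge0// ?expR_ge0//.
    have k1 : kf eps t <= a^-1 + eps.
      have /andP[h0 _] := he; rewrite (le_trans (kf_le h0 t0))// lerD2r.
      by rewrite lef_pV2 ?posrE// ltW.
    have k0 := kf_gt0 eps t0.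
    have h1 : n%:R * kf eps t * u t ^+ 2 <= n%:R * (a^-1 + eps) * u t ^+ 2.
      by rewrite ler_wpM2r ?sqr_ge0// ler_wpM2l.
    have h2 : `|f (v t)| <= (p + 2) * `|v t|.
      have := nonlin_lip1 p0 (v t) 0 hmu; rewrite (@nonlin_le0 _ p p0 _ 0)//.
      by rewrite !subr0.
    have h3 : 2 * `|u t| * `|f (v t)| <= (p + 2) * q t.
      have : 2 * `|u t| * `|f (v t)| <= 2 * `|u t| * ((p + 2) * `|v t|).
        by rewrite ler_wpM2l// mulr_ge0.
      move=> /le_trans; apply.
      have : 2 * `|u t| * `|v t| <= q t.
        rewrite /q -(real_normK (num_real (u t))) -(real_normK (num_real (v t))).
        by have := sqr_ge0 (`|u t| - `|v t|); nra.
      have pp := p0; have p2 : 0 <= p + 2 by lra.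
      by move=> /(ler_wpM2l p2); lra.
    have h4 : u t * f (v t) <= `|u t| * `|f (v t)| by rewrite -normrM ler_norm.
    have h5 := sqr_ge0 (u t + v t).
    have h6 : 0 <= n%:R * (a^-1 + eps) * v t ^+ 2.
      have /andP[h0 _] := he.
      by rewrite mulr_ge0 ?sqr_ge0// mulr_ge0// addr_ge0// invr_ge0 ltW.
    rewrite /K; move: h1 h3 h4 h5 h6; rewrite /q; nra.
rewrite {1}/q vz uz expr0n/= addr0 mul0r oppr0 oppr_ge0.
rewrite pmulr_lle0 ?expR_gt0// /q => h.
have h1 := sqr_ge0 (u a); have h2 := sqr_ge0 (v a).
have : u a ^+ 2 = 0 by lra.
by move/eqP; rewrite sqrf_eq0 => /eqP.
Qed.

Section WithPotential.
Variables (G Q : R -> R).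
Hypotheses (cG : continuous G) (cQ : continuous Q) (G0 : G 0 = 0) (Q0 : Q 0 = 0).
Hypothesis dF : forall x, 0 < x -> der (fun t => G t - mu * Q t) x (f x).
Hypothesis FE : forall x, 0 <= x <= 1 ->
  G x - mu * Q x = x ^+ 2 * (x `^ p / (p + 2) - mu / 2).

(* The energy, dissipated by the first-order term n k u of the equation. *)
Local Notation E s := (u s ^+ 2 / 2 + (G (v s) - mu * Q (v s))).

Lemma energy_nincr a b : 0 <= a -> a <= b -> (forall t, a < t < b -> 0 < v t) ->
  E b <= E a.
Proof.
move=> a0 ab vpos.
apply: (@nincr_le R (fun s => u s ^+ 2 / 2 + (G (v s) - mu * Q (v s)))
  (fun s => - (n%:R * kf eps s * u s ^+ 2))) => // t tab.
- have /andP[at_ tb] := tab; have t0 := le_lt_trans a0 at_.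
  apply: (@der_ext _ (fun s => 2^-1 * u s ^+ 2 + (G (v s) - mu * Q (v s)))).
  + by apply/funext => r; rewrite [2^-1 * _]mulrC.
  + exact: erefl.
  have d1 := derX 2 (fam_der_u vu t0).
  have d2 := der_comp (dF (vpos t tab)) (radsol_derv vu t0).
  by apply: der_ext (derD (derZ _ d1) d2) => //; rewrite expr1; field.
- apply: contD; first by apply: contM; [exact: contX|exact: cont_cst].
  by apply: contB; [exact: cont_comp|apply: contZ; exact: cont_comp].
- have /andP[at_ tb] := tab; have t0 := le_lt_trans a0 at_.
  by rewrite oppr_le0 mulr_ge0 ?sqr_ge0// mulr_ge0// ltW// kf_gt0.
Qed.

(** Once the energy is negative the solution cannot vanish any more. *)
Lemma energy_neg_pos s1 s : 0 <= s1 -> E s1 < 0 ->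
  (forall t, 0 <= t <= s1 -> 0 < v t) -> 0 <= s -> 0 < v s.
Proof.
move=> s10 E1 vpos s0; have [ss1|s1s] := leP s s1; first by apply: vpos; rewrite s0.
rewrite ltNge; apply/negP => vs.
have [|z [/andP[s1z zs] vz zpos]] := first_zero (ltW s1s) cv _ vs.
  by apply: vpos; rewrite s10 lexx.
have : E z <= E s1.
  apply: energy_nincr => //; first exact: ltW.
  by move=> t /andP[st tz]; apply: zpos; rewrite tz ltW.
by rewrite vz G0 Q0; have := sqr_ge0 (u z); lra.
Qed.

(** If the derivative vanishes somewhere, then the energy becomes negative
    before the solution vanishes. *)
Lemma monotone_or_negative_energy : (forall s, 0 <= s -> 0 <= v s) ->
  (forall s, 0 < s -> u s < 0) \/
  exists s1, [/\ 0 <= s1, E s1 < 0 & forall t, 0 <= t <= s1 -> 0 < v t].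
Proof.
move=> v_ge0.
have [?|/existsNP[b /not_implyP[b0 /negP]]] :=
  pselect (forall s, 0 < s -> u s < 0); [by left|rewrite -leNgt => ub; right].
have [s0 s0p us0] := u_neg_near0.
have s0b : s0 <= b.
  by rewrite leNgt; apply/negP => bs; move: (us0 b); rewrite b0 ltW// => /(_ isT); lra.
have us00 : 0 < - u s0 by rewrite oppr_gt0 us0// s0p lexx.
have [|z [/andP[s0z zb] uz0 zneg]] := first_zero s0b (contN cu) us00; first by lra.
have uz : u z = 0 by lra.
have un t : 0 < t < z -> u t < 0.
  move=> /andP[t0 tz]; have [ts|/ltW st] := leP t s0; first by apply: us0; rewrite t0.
  by rewrite -oppr_gt0 zneg// st.
have z0 := lt_trans s0p s0z.
have vz_lt t : 0 <= t -> t < z -> v z < v t.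
  move=> t0 tz; apply: v_decr => // r /andP[tr rz]; apply: un.
  by rewrite rz (le_lt_trans t0).
have vz1 : v z < 1 by rewrite -(radsol_v0 vu) vz_lt.
have vz : 0 < v z.
  rewrite lt_def v_ge0 ?ltW// andbT; apply/eqP => vz.
  by have := no_double_zero s0p s0z vz uz; lra.
have fz : f (v z) <= 0.
  rewrite leNgt; apply/negP => fz.
  have /nbhs_ballP[d /= d0 Hd] : \forall x \near z, 0 < f (v x).
    exact: (@cvgr_gt _ _ _ _ (fun s => f (v s)) _ (@cfv z)).
  pose a := Num.max s0 (z - d / 2).
  have az : s0 <= a < z by rewrite /a le_max lexx gt_max s0z/=; lra.
  have ad : z - d / 2 <= a by rewrite /a le_max lexx orbT.
  have a0 : 0 < a by case/andP: az => + _; exact: lt_le_trans.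
  have /andP[sa az'] := az.
  have : wt n eps z * u z < wt n eps a * u a.
    apply: flux_decr => //; first exact: ltW.
    by move=> t /andP[at_ tz]; apply: Hd; rewrite /ball/= gtr0_norm; lra.
  rewrite uz mulr0 pmulr_rgt0 ?wt_gt0// => ua.
  by have := un a; rewrite a0 az' => /(_ isT); lra.
have vz01 : 0 <= v z <= 1 by rewrite !ltW.
move: fz; rewrite nonlinE// (powRS p0 (ltW vz)) => fz.
have vp : v z `^ p <= mu by rewrite -(ler_pM2l vz); lra.
have vpp : 0 < v z `^ p by rewrite powR_gt0.
exists z; split; first exact: ltW.
- rewrite uz expr0n/= mul0r add0r FE// pmulr_rlt0 ?exprn_gt0//.
  have pp := p0; have p2 : 0 < p + 2 by lra.
  (* v z ^ p / (p + 2) <= mu / (p + 2) < mu / 2 as p > 0. *)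
  rewrite subr_lt0 ltr_pdivrMr//; nra.
- move=> t /andP[t0]; rewrite le_eqVlt => /predU1P[->//|tz].
  exact: lt_trans vz (vz_lt t t0 tz).
Qed.

End WithPotential.
End Qualitative.

(** * The Lane-Emden limit *)

Section LaneEmden.
Context {R : realType}.
Implicit Types (x y s t : R).
Variables (n : nat) (lam p e1 : R).
Hypotheses (n0 : (0 < n)%N) (lam0 : 0 < lam) (p0 : 0 < p) (e10 : 0 <= e1).
Hypothesis (le1 : lam * e1 ^+ 2 < 1).
Variables (v u : R -> R).
Hypothesis vu : fam n lam p 0 v u.
(* To be refuted in the subcritical range. *)
Hypothesis v_ge0 : forall s, 0 <= s -> 0 <= v s.

Let he : 0 <= (0 : R) <= e1.
Proof. by rewrite lexx. Qed.

Let mu0 : lam * 0 ^+ 2 = 0.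
Proof. by rewrite expr0n mulr0. Qed.

Let cv : continuous v := radsol_contv vu.
Let cu : continuous u := radsol_contu vu.

Let wE s : wt n 0 s = s ^+ n.
Proof. by rewrite /wt /Sf eqxx. Qed.

Let kE s : kf 0 s = s^-1.
Proof. by rewrite /kf /Sf eqxx mul0r cosh0 mul1r. Qed.

Let nonlin_ge0 x : 0 <= nonlin p (lam * 0 ^+ 2) x.
Proof. by rewrite /nonlin mu0 mul0r subr0 powR_ge0. Qed.

Lemma lane_emden_u_neg s : 0 < s -> u s < 0.
Proof.
move=> s0; have [s1 s10 us1] := u_neg_near0 lam0 p0 e10 le1 he vu.
have [ss1|/ltW s1s] := leP s s1; first by apply: us1; rewrite s0.
have : wt n 0 s * u s <= wt n 0 s1 * u s1.
  apply: (@nincr_le R (fun t => wt n 0 t * u t)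
    (fun t => - (wt n 0 t * nonlin p (lam * 0 ^+ 2) (v t)))) => // t.
  - by move=> /andP[t1 _]; apply: (radsol_deru vu); exact: lt_trans t1.
  - by move=> _; apply: contM => //; exact: cont_wt.
  - move=> /andP[t1 _]; rewrite oppr_le0 mulr_ge0// ltW// wt_gt0//.
    exact: lt_trans t1.
have us1' : u s1 < 0 by apply: us1; rewrite s10 lexx.
have : wt n 0 s1 * u s1 < 0 by rewrite pmulr_rlt0// wt_gt0.
by move=> /[swap] /le_lt_trans/[apply]; rewrite pmulr_rlt0// wt_gt0.
Qed.

Let v_dec s t : 0 <= s -> s < t -> v t < v s.
Proof.
move=> s0 st; apply: (v_decr vu) => // r /andP[sr _].
by apply: lane_emden_u_neg; exact: le_lt_trans sr.
Qed.

Lemma lane_emden_v_pos s : 0 <= s -> 0 < v s.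
Proof.
move=> s0; have s1 : s < s + 1 by lra.
by apply: le_lt_trans (v_dec s0 s1); apply: v_ge0; lra.
Qed.

Let v_le1 s : 0 <= s -> 0 <= v s <= 1.
Proof.
move=> s0; rewrite v_ge0//=; move: s0; rewrite le_eqVlt => /predU1P[<-|s0].
  by rewrite (radsol_v0 vu).
by rewrite -(radsol_v0 vu) ltW// v_dec.
Qed.

Let du s : 0 < s -> der (fun t => t ^+ n * u t) s (- (s ^+ n * v s `^ (p + 1))).
Proof.
move=> s0; apply: der_ext (radsol_deru vu s0).
  by apply/funext => t; rewrite wE.
by rewrite wE nonlinE ?v_le1 ?ltW// mu0 mul0r subr0.
Qed.

Let N1 : n.+1%:R != 0 :> R.
Proof. by rewrite pnatr_eq0. Qed.

Lemma der_pow m (c s : R) : der (fun t => c * t ^+ m.+1) s (c * m.+1%:R * s ^+ m).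
Proof.
by apply: der_ext (derZ c (derX m.+1 (der_id s))) => //; rewrite mulr1 mulrA.
Qed.

(** The mean of the source over a ball is at least its boundary value. *)
Lemma lane_emden_u_le s : 0 < s -> u s <= - (s * v s `^ (p + 1) / n.+1%:R).
Proof.
move=> s0; set a := v s `^ (p + 1).
have : s ^+ n * u s + a / n.+1%:R * s ^+ n.+1 <=
    0 ^+ n * u 0 + a / n.+1%:R * 0 ^+ n.+1.
  apply: (@nincr_le R (fun t => t ^+ n * u t + a / n.+1%:R * t ^+ n.+1)
    (fun t => - (t ^+ n * v t `^ (p + 1)) + a / n.+1%:R * n.+1%:R * t ^+ n)).
  - exact: ltW.
  - by move=> t /andP[t0 _]; apply: derD; [exact: du|exact: der_pow].
  - move=> t _; apply: contD; first by apply: contM => //; exact: exprn_continuous.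
    by apply: contZ; exact: exprn_continuous.
  - move=> t /andP[t0 ts]; rewrite divfK//.
    have pp := p0.
    have : a <= v t `^ (p + 1).
      apply: ge0_ler_powR; rewrite ?nnegrE ?v_ge0 ?(ltW t0) ?(ltW s0)//; first by lra.
      by rewrite ltW// v_dec// ltW.
    have : 0 <= t ^+ n by rewrite exprn_ge0// ltW.
    by nra.
rewrite (radsol_u0 vu) mulr0 (exprS 0 n) mul0r mulr0 addr0 exprSr.
have -> : s ^+ n * u s + a / n.+1%:R * (s ^+ n * s) =
  s ^+ n * (u s + s * a / n.+1%:R) by ring.
by rewrite pmulr_rle0 ?exprn_gt0// -[u s <= _]subr_le0 opprK.
Qed.

(** Integrating [(v ^ (- p))' >= p s / (n + 1)], a consequence of the previous
    bound. *)
Lemma lane_emden_decay s : 0 < s -> v s `^ p * s ^+ 2 <= 2 * n.+1%:R / p.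
Proof.
move=> s0; have pp := p0; have pn0 : p != 0 by rewrite gt_eqF.
have np : 0 < n.+1%:R :> R by rewrite ltr0n.
pose c := p / (2 * n.+1%:R).
have c0 : 0 < c by rewrite divr_gt0// mulr_gt0.
have h : c * s ^+ 2 - v s `^ (- p) <= c * 0 ^+ 2 - v 0 `^ (- p).
  apply: (@nincr_le R (fun t => c * t ^+ 2 - v t `^ (- p))
    (fun t => c * 2%:R * t ^+ 1 - (- p * v t `^ (- p - 1) * u t))).
  - exact: ltW.
  - move=> t /andP[t0 _]; apply: derB; first exact: der_pow.
    apply: (@der_comp _ (fun x => x `^ (- p)) v).
      by apply: der_powR; apply: lane_emden_v_pos; exact: ltW.
    exact: (radsol_derv vu).
  - move=> t /andP[t0 _]; apply: continuousB.
      by apply: contZ; exact: exprn_continuous.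
    apply: (@continuous_comp _ _ _ v (fun x => x `^ (- p))); first exact: cv.
    exact: (der_cont (der_powR (- p) (lane_emden_v_pos t0))).
  - move=> t /andP[t0 ts]; have vt := lane_emden_v_pos (ltW t0).
    have := lane_emden_u_le t0.
    set a := v t `^ (- p - 1); have a0 : 0 < a by rewrite powR_gt0.
    have ab : a * v t `^ (p + 1) = 1.
      rewrite /a -powRD; last by rewrite (gt_eqF vt)/= implybT.
      by have -> : - p - 1 + (p + 1) = 0; [ring|rewrite powRr0].
    move=> /(ler_wpM2l (ltW a0)); rewrite mulrN.
    have -> : a * (t * v t `^ (p + 1) / n.+1%:R) = (a * v t `^ (p + 1)) * (t / n.+1%:R).
      by field.
    rewrite ab mul1r => /(ler_wpM2l (ltW pp)).
    have -> : c * 2%:R * t ^+ 1 = p * (t / n.+1%:R) by rewrite /c expr1; field.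
    by set b := t / _; lra.
have vs := lane_emden_v_pos (ltW s0).
have vp : 0 < v s `^ p by rewrite powR_gt0.
move: h; rewrite expr0n/= mulr0 add0r.
rewrite powRN.
have h1 : 0 <= v 0 `^ (- p) by rewrite powR_ge0.
move=> h; have : c * s ^+ 2 <= (v s `^ p)^-1 by lra.
rewrite -[_^-1]mul1r ler_pdivlMr// => h2.
have -> : 2 * n.+1%:R / p = c^-1 by rewrite /c invf_div.
by rewrite -[c^-1]mul1r ler_pdivlMr//; lra.
Qed.

(* The Pohozaev functional. *)
Let P s := s ^+ n.+1 * (u s ^+ 2 / 2 + v s * v s `^ (p + 1) / (p + 2))
  + (n%:R - 1) / 2 * (s ^+ n * u s * v s).

Let c0 : R := n.+1%:R / (p + 2) - (n%:R - 1) / 2.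

Lemma der_pohozaev s : 0 < s -> der P s (c0 * (s ^+ n * (v s * v s `^ (p + 1)))).
Proof.
move=> s0; have pp := p0; have vs := lane_emden_v_pos (ltW s0).
have p2 : p + 2 != 0 by rewrite gt_eqF//; lra.
have sn0 : s != 0 by rewrite gt_eqF.
have dv := radsol_derv vu s0.
have du2 := fam_der_u vu s0.
rewrite kE nonlinE ?v_le1 ?ltW// mu0 mul0r subr0 in du2.
have dvp := der_comp (der_powR (p + 1) vs) dv.
have dX := derX n.+1 (der_id s).
have d1 := derD (derM (derX 2 du2) (der_cst 2^-1 s))
  (derM (derM dv dvp) (der_cst (p + 2)^-1 s)).
have d := derD (derM dX d1) (derZ ((n%:R - 1) / 2) (derM (du s0) dv)).
apply: der_ext d => //.
rewrite /c0 addrK powRS ?(ltW vs)// expr1 exprS /= -natr1.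
by field; rewrite p2 sn0.
Qed.

Let cvp t : 0 <= t -> {for t, continuous (fun s => v s `^ (p + 1))}.
Proof.
move=> t0; apply: (@continuous_comp _ _ _ v (fun x => x `^ (p + 1))); first exact: cv.
exact: (der_cont (der_powR (p + 1) (lane_emden_v_pos t0))).
Qed.

Let cP t : 0 <= t -> {for t, continuous P}.
Proof.
move=> t0; apply: continuousD.
  apply: continuousM; first exact: exprn_continuous.
  apply: continuousD.
    by apply: continuousM; [exact: contX|exact: cvg_cst].
  apply: continuousM; last exact: cvg_cst.
  by apply: continuousM; [exact: cv|exact: cvp].
apply: continuousM; first exact: cvg_cst.
by apply: continuousM; [apply: contM => //; exact: exprn_continuous|exact: cv].
Qed.

Hypothesis subcritical : (n%:R - 1) * p < 4.

Let c0_gt0 : 0 < c0.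
Proof.
have pp := p0; have sc := subcritical.
rewrite /c0 subr_gt0 ltr_pdivrMr// mulrAC ltr_pdivlMr; last by lra.
by rewrite -natr1; nra.
Qed.

Lemma pohozaev_incr s t : 0 <= s -> s < t -> P s < P t.
Proof.
move=> s0 st; suff : - P t < - P s by lra.
apply: (@decr_lt R (fun x => - P x)
  (fun x => - (c0 * (x ^+ n * (v x * v x `^ (p + 1)))))) => // x.
- by move=> /andP[sx _]; apply: derN; apply: der_pohozaev; exact: le_lt_trans sx.
- by move=> /andP[sx _]; apply: continuousN; apply: cP; exact: le_trans sx.
- move=> /andP[sx _]; have x0 := le_lt_trans s0 sx.
  have vx := lane_emden_v_pos (ltW x0).
  by rewrite oppr_lt0 !mulr_gt0// ?exprn_gt0// powR_gt0.
Qed.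

Let P1_gt0 : 0 < P 1.
Proof.
have := pohozaev_incr (lexx 0) (ltr01 : 0 < 1 :> R).
by rewrite {1}/P (radsol_u0 vu) exprS !mul0r mulr0 mul0r mulr0 addr0.
Qed.

(** The Lane-Emden solution takes negative values in the subcritical range.
    Otherwise
    the Pohozaev functional is bounded below by [P 1 > 0]; at a point of
    [[s, 2 s]] where [`|u| <= v s / s], it is at most a constant times
    [s ^ (n - 1) * v s ^ 2], hence at most a power of [s] with negative exponent
    [n - 1 - 4 / p]. *)
Lemma lane_emden_contradiction : False.
Proof.
have pp := p0; have sc := subcritical.
pose C := 2 * n.+1%:R / p.
have C0 : 0 < C by rewrite divr_gt0// mulr_gt0// ltr0n.
pose C2 := 2 ^+ n.+1 * (1 / 2 + C / (p + 2)).
have C20 : 0 < C2.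
  by rewrite mulr_gt0 ?exprn_gt0// addr_gt0 ?divr_gt0//; lra.
have key s : 1 <= s -> P 1 <= C2 * (s ^+ n.-1 * v s ^+ 2).
  move=> s1; have s0 : 0 < s by lra.
  have s2 : s < 2 * s by lra.
  have [x /andP[sx x2s]] : exists2 x, s < x < 2 * s & v (2 * s) - v s = u x * (2 * s - s).
    apply: mvt => // x; first by move=> /andP[sx _]; apply: (radsol_derv vu); lra.
    by move=> _; exact: cv.
  have -> : 2 * s - s = s by ring.
  move=> vux; have x0 : 0 < x by lra.
  have ux := lane_emden_u_neg x0.
  have vx := lane_emden_v_pos (ltW x0); have vs := lane_emden_v_pos (ltW s0).
  have vxs : v x <= v s by rewrite ltW// v_dec// ltW.
  have v2s : 0 <= v (2 * s) by apply: v_ge0; lra.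
  have P1x : P 1 <= P x.
    move: s1; rewrite le_eqVlt => /predU1P[->|s1]; first by rewrite ltW// pohozaev_incr// ltW.
    by rewrite ltW// pohozaev_incr//; lra.
  apply: (le_trans P1x); rewrite /P.
  have hneg : (n%:R - 1) / 2 * (x ^+ n * u x * v x) <= 0.
    rewrite mulr_ge0_le0//; first by rewrite divr_ge0// subr_ge0 ler1n.
    by rewrite mulr_le0_ge0 ?(ltW vx)// mulr_ge0_le0 ?exprn_ge0 ?(ltW x0)// ltW.
  have usq : u x ^+ 2 <= v s ^+ 2 / s ^+ 2.
    rewrite ler_pdivlMr ?exprn_gt0// -exprMn -[u x * s]opprK sqrrN.
    have h : 0 <= - (u x * s) by rewrite oppr_ge0 mulr_le0_ge0 ?(ltW ux)// ltW.
    by rewrite lerXn2r ?nnegrE ?(ltW vs)//; lra.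
  have vpx : v x * v x `^ (p + 1) <= v s ^+ 2 * (C / s ^+ 2).
    rewrite powRS ?(ltW vx)// mulrA -expr2; apply: ler_pM.
    - by rewrite exprn_ge0// ltW.
    - exact: powR_ge0.
    - by rewrite lerXn2r// nnegrE ltW.
    - rewrite ler_pdivlMr ?exprn_gt0//.
      apply: le_trans (lane_emden_decay s0); rewrite ler_wpM2r ?exprn_ge0 ?(ltW s0)//.
      by apply: ge0_ler_powR; rewrite ?nnegrE ?(ltW pp) ?(ltW vx) ?(ltW vs)//.
  have bra : u x ^+ 2 / 2 + v x * v x `^ (p + 1) / (p + 2) <=
      (1 / 2 + C / (p + 2)) * (v s ^+ 2 / s ^+ 2).
    have i0 : 0 <= (p + 2)^-1 by rewrite invr_ge0; lra.
    by have := ler_wpM2r i0 vpx; lra.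
  have xn : x ^+ n.+1 <= 2 ^+ n.+1 * s ^+ n.+1.
    by rewrite -exprMn lerXn2r// ?nnegrE; lra.
  have bra0 : 0 <= u x ^+ 2 / 2 + v x * v x `^ (p + 1) / (p + 2).
    rewrite addr_ge0 ?divr_ge0 ?sqr_ge0 ?mulr_ge0 ?powR_ge0 ?(ltW vx)//; lra.
  have xn0 : 0 <= x ^+ n.+1 by rewrite exprn_ge0// ltW.
  have := ler_pM xn0 bra0 xn bra.
  have -> : 2 ^+ n.+1 * s ^+ n.+1 * ((1 / 2 + C / (p + 2)) * (v s ^+ 2 / s ^+ 2)) =
     C2 * (s ^+ n.-1 * v s ^+ 2).
    rewrite /C2; case: n n0 => [//|m] _ /=.
    have -> : s ^+ m.+2 = s ^+ m * s ^+ 2 by rewrite -exprD addn2.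
    have sn0 : s != 0 by rewrite gt_eqF.
    have p2 : p + 2 != 0 by rewrite gt_eqF//; lra.
    by field; rewrite ?sn0 ?p2.
  lra.
(* Raising the lower bound on v s ^ 2 to the power p / 2 turns it into a bound on
   v s ^ p, to be compared with the decay. *)
pose q := p / 2; have q0 : 0 < q by rewrite /q; lra.
pose th := 2 - (n%:R - 1) * q.
have th0 : 0 < th by rewrite /th /q; lra.
pose c := P 1 / C2; have cpos : 0 < c by rewrite divr_gt0.
have bound s : 1 <= s -> c `^ q * s `^ th <= C.
  move=> s1; have s0 : 0 < s by lra.
  have vs := lane_emden_v_pos (ltW s0).
  have h1 : c <= s ^+ n.-1 * v s ^+ 2 by rewrite ler_pdivrMr// mulrC key.
  have h2 : c `^ q <= (s ^+ n.-1 * v s ^+ 2) `^ q.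
    apply: ge0_ler_powR; rewrite ?nnegrE ?(ltW q0) ?(ltW cpos)//.
    by rewrite mulr_ge0// ?exprn_ge0// ltW.
  have h3 : (s ^+ n.-1 * v s ^+ 2) `^ q = s `^ ((n%:R - 1) * q) * v s `^ p.
    rewrite powRM ?exprn_ge0 ?(ltW s0) ?(ltW vs)//.
    rewrite -!powR_mulrn ?(ltW s0) ?(ltW vs)// -!powRrM.
    congr (_ `^ _ * _ `^ _); last by rewrite /q; field.
    by congr (_ * _); case: n n0 => //= m _; rewrite -natr1 addrK.
  have h4 : s `^ ((n%:R - 1) * q) * s `^ th = s ^+ 2.
    rewrite -powRD; last by rewrite (gt_eqF s0) implybT.
    by rewrite /th addrC subrK powR_mulrn// ltW.
  have := ler_wpM2r (powR_ge0 s th) h2.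
  rewrite h3 mulrAC h4 => /le_trans; apply.
  by rewrite mulrC; exact: lane_emden_decay.
pose K := C / c `^ q; have cq : 0 < c `^ q by rewrite powR_gt0.
have K0 : 0 < K by rewrite divr_gt0.
have s1 : 1 <= (1 + K) `^ th^-1.
  rewrite -[leLHS](powRr0 (1 + K)); apply: ler_powR; first by lra.
  by rewrite invr_ge0 ltW.
have := bound _ s1; rewrite -powRrM mulVf ?gt_eqF// powRr1; last by lra.
by rewrite mulrC -ler_pdivlMr// -/K; lra.
Qed.

End LaneEmden.

(** * The shooting argument *)

Section Shooting.
Context {R : realType}.
Implicit Types (x y s t eps : R).

(** The parameter is the supremum of those [eps] for which the solution takes a
    negative value.  At the supremum the solution is nonnegative; if it were
    not decreasing, its energy would become negative while it is positive, and
    this would persist for nearby parameters, whose solutions would then stay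
    positive. *)
Theorem shooting (n : nat) (lam p : R) : (0 < n)%N -> 0 < lam -> 0 < p ->
  (n%:R - 1) * p < 4 ->
  exists eps v u, [/\ 0 < eps, lam * eps ^+ 2 < 1, fam n lam p eps v u,
    forall s, 0 < s -> u s < 0 & forall s, 0 <= s -> 0 < v s <= 1].
Proof.
move=> n0 lam0 p0 sub.
have p2 : 0 < p + 2 by lra.
(* For eps = e1 the initial energy is negative, yet lam e1 ^ 2 < 1. *)
pose m := (2 / (p + 2) + 1) / 2.
have mm : 2 / (p + 2) < m < 1.
  have : 2 / (p + 2) < 1 by rewrite ltr_pdivrMr//; lra.
  by rewrite /m => ?; lra.
have m0 : 0 < m by have : 0 < 2 / (p + 2); [exact: divr_gt0|lra].
pose e1 := Num.sqrt (m / lam).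
have e10 : 0 <= e1 by exact: sqrtr_ge0.
have e1E : lam * e1 ^+ 2 = m.
  rewrite sqr_sqrtr; last by rewrite divr_ge0 ?(ltW m0) ?(ltW lam0).
  by rewrite mulrCA mulfV ?mulr1// gt_eqF.
have le1 : lam * e1 ^+ 2 < 1 by rewrite e1E; case/andP: mm.
(* All parameters are clamped to [0, e1], so that solutions are chosen for every
   real number. *)
pose cl eps := Num.min (Num.max eps 0) e1.
have clP eps : 0 <= cl eps <= e1.
  by rewrite /cl le_min ge_min le_max !lexx !orbT e10.
have cl_id eps : 0 <= eps <= e1 -> cl eps = eps.
  by move=> /andP[h0 h1]; rewrite /cl max_l// min_l.
have /choice[VU VUP] : forall eps, exists vu : (R -> R) * (R -> R),
    fam n lam p (cl eps) vu.1 vu.2.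
  move=> eps; have [v [u vu]] := fam_exists n0 lam0 p0 e10 (ltW le1) (clP eps).
  by exists (v, u).
pose V eps := (VU eps).1; pose U eps := (VU eps).2.
have sol eps : fam n lam p (cl eps) (V eps) (U eps) by exact: VUP.
have dep S : 0 <= S -> exists C, forall eps eps' s, 0 <= s <= S ->
    `|V eps s - V eps' s| <= C * `|eps - eps'| /\
    `|U eps s - U eps' s| <= C * `|eps - eps'|.
  move=> S0; have [C HC] := fam_dependence n0 lam0 p0 e10 (ltW le1) S0.
  exists `|C| => eps eps' s sS.
  have [h1 h2] := HC _ _ _ _ _ _ (clP eps) (clP eps') (sol eps) (sol eps') s sS.
  have h : C * `|cl eps - cl eps'| <= `|C| * `|eps - eps'|.
    apply: (@le_trans _ _ (`|C| * `|cl eps - cl eps'|)).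
      by rewrite ler_wpM2r// ler_norm.
    by rewrite ler_wpM2l// min_max_lip.
  by split; [exact: le_trans h1 h|exact: le_trans h2 h].
have [G [Q [cG cQ G0 Q0 GQ]]] := potentials p0.
pose E eps s := U eps s ^+ 2 / 2 + (G (V eps s) - lam * cl eps ^+ 2 * Q (V eps s)).
pose B := [set eps | 0 <= eps <= e1 /\ exists2 s, 0 <= s & V eps s < 0].
have AB eps s1 : 0 <= s1 -> E eps s1 < 0 -> (forall t, 0 <= t <= s1 -> 0 < V eps t) ->
    ~ B eps.
  move=> s10 E1 pos [_ [s s0 Vs]].
  have [dF _] := GQ (lam * cl eps ^+ 2).
  have := energy_neg_pos (sol eps) cG cQ G0 Q0 dF s10 E1 pos s0.
  by lra.
have B0 : B 0.
  split; first by rewrite lexx.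
  apply: contrapT => /forall2NP nB.
  have vu := sol 0; rewrite cl_id ?lexx// in vu.
  apply: (lane_emden_contradiction n0 lam0 p0 e10 le1 vu _ sub) => s s0.
  by rewrite leNgt; apply/negP => Vs; case: (nB s).
have nB1 : ~ B e1.
  apply: (@AB e1 0) => //.
    rewrite /E (radsol_u0 (sol e1)) (radsol_v0 (sol e1)).
    have [_ ->] := GQ (lam * cl e1 ^+ 2); last by rewrite ler01 lexx.
    rewrite cl_id ?e10 ?lexx// e1E powR1 expr0n/= mul0r add0r expr1n !mul1r.
    by case/andP: mm; lra.
  by move=> t; rewrite -eq_le => /eqP <-; rewrite (radsol_v0 (sol e1)).
have supB : has_sup B by split; [exists 0|exists e1 => x [/andP[]]].
pose es := sup B.
have es0 : 0 <= es by exact: sup_upper_bound.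
have es1 : es <= e1 by apply: ge_sup; [exists 0|move=> x [/andP[]]].
have esE : cl es = es by rewrite cl_id// es0.
have nBs : ~ B es.
  move=> [_ [s s0 Vs]].
  have [C HC] := dep s s0.
  have C1 : 0 < `|C| + 1 by rewrite ltr_wpDl.
  pose d := - V es s / (`|C| + 1).
  have d0 : 0 < d by rewrite divr_gt0// oppr_gt0.
  have ltes : es < e1.
    rewrite lt_neqAle es1 andbT; apply/eqP => E1; apply: nB1; split.
      by rewrite e10 lexx.
    by exists s => //; rewrite -E1.
  pose e := Num.min e1 (es + d / 2).
  have ese : es < e <= e1 by rewrite /e lt_min ge_min lexx ltes/=; lra.
  have ed : e <= es + d / 2 by rewrite /e ge_min lexx orbT.
  have Be : B e.
    have /andP[h1 h2] := ese.
    split; first by rewrite h2 andbT; lra.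
    exists s => //.
    have [|h _] := HC e es s; first by rewrite s0 lexx.
    have : C * `|e - es| <= (`|C| + 1) * (d / 2).
      apply: (@le_trans _ _ ((`|C| + 1) * `|e - es|)).
        by rewrite ler_wpM2r// (le_trans (ler_norm C))// lerDl.
      by rewrite ler_pM2l// ger0_norm; lra.
    have -> : (`|C| + 1) * (d / 2) = - V es s / 2.
      by rewrite /d; field; rewrite gt_eqF.
    by move: h; rewrite ler_norml; lra.
  have := sup_upper_bound supB Be; rewrite -/es.
  by case/andP: ese; lra.
have es_gt0 : 0 < es.
  by rewrite lt_neqAle es0 andbT; apply/eqP => E0; apply: nBs; rewrite -E0.
have nA s1 : 0 <= s1 -> E es s1 < 0 -> (forall t, 0 <= t <= s1 -> 0 < V es t) -> False.
  move=> s10 E1 pos.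
  have [C HC] := dep s1 s10.
  have contE : {for es, continuous (fun eps => E eps s1)}.
    have s11 : 0 <= s1 <= s1 by rewrite s10 lexx.
    have cU : continuous (fun eps => U eps s1).
      move=> x; apply: (@lip_cont _ (fun eps => U eps s1) x C) => y _.
      by have [] := HC y x s1 s11.
    have cV : continuous (fun eps => V eps s1).
      move=> x; apply: (@lip_cont _ (fun eps => V eps s1) x C) => y _.
      by have [] := HC y x s1 s11.
    have ccl : continuous cl.
      by move=> x; apply: (@lip_cont _ cl x 1) => y _; rewrite mul1r min_max_lip.
    suff : continuous (fun eps => E eps s1) by move=> /(_ es).
    apply: contD; first by apply: contM; [exact: contX|exact: cont_cst].
    apply: contB; first exact: cont_comp.
    apply: contM; last exact: cont_comp.
    by apply: contZ; exact: contX.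
  have /nbhs_ballP[d1 /= d10 Hd1] : \forall x \near es, E x s1 < 0.
    exact: (@cvgr_lt _ _ _ _ (fun eps => E eps s1) _ contE).
  have [c cs1 cmin] : exists2 c, c \in `[0, s1] & forall t, t \in `[0, s1] -> V es c <= V es t.
    apply: EVT_min => //; apply: continuous_subspaceT.
    exact: (radsol_contv (sol es)).
  have Vc : 0 < V es c by apply: pos; move: cs1; rewrite in_itv.
  have C1 : 0 < `|C| + 1 by rewrite ltr_wpDl.
  pose d2 := V es c / (`|C| + 1).
  have d20 : 0 < d2 by rewrite divr_gt0.
  pose d := Num.min d1 d2.
  have d0 : 0 < d by rewrite lt_min d10.
  have [e Be ltde] := sup_adherent d0 supB.
  have lees : e <= es by exact: sup_upper_bound.
  have ed : `|e - es| < d by rewrite distrC ger0_norm; move: ltde; rewrite -/es; lra.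
  apply: (@AB e s1 s10 _ _ Be).
    by apply: Hd1; rewrite /ball/= distrC (lt_le_trans ed)// ge_min lexx.
  move=> t ts1; have [h _] := HC e es t ts1.
  have ct : V es c <= V es t by apply: cmin; rewrite in_itv.
  have : C * `|e - es| < V es c.
    apply: (@le_lt_trans _ _ ((`|C| + 1) * `|e - es|)).
      by rewrite ler_wpM2r// (le_trans (ler_norm C))// lerDl.
    rewrite mulrC -ltr_pdivlMr//; apply: (lt_le_trans ed).
    by rewrite ge_min lexx orbT.
  by move: h; rewrite ler_norml; lra.
have Vge0 s : 0 <= s -> 0 <= V es s.
  move=> s0; rewrite leNgt; apply/negP => Vs; apply: nBs; split; first by rewrite es0.
  by exists s.
have vu := sol es; have clp := clP es.
have [dF FE] := GQ (lam * cl es ^+ 2).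
have [un|[s1 [s10 E1 pos]]] :=
  monotone_or_negative_energy lam0 p0 e10 le1 clp vu FE Vge0; last first.
  by have := nA s1 s10 E1 pos.
have dec s t : 0 <= s -> s < t -> V es t < V es s.
  by move=> s0 st; apply: (v_decr vu) => // r /andP[sr _]; apply: un; lra.
exists es, (V es), (U es); split => //.
- apply: le_lt_trans le1; rewrite ler_pM2l// lerXn2r//.
- by rewrite -{1}esE.
- move=> s s0; apply/andP; split.
    have ss : s < s + 1 by lra.
    by apply: le_lt_trans (dec _ _ s0 ss); apply: Vge0; lra.
  move: s0; rewrite le_eqVlt => /predU1P[<-|s0]; first by rewrite (radsol_v0 vu).
  by rewrite -(radsol_v0 vu) ltW// dec.
Qed.

End Shooting.

(** * Radial functions on hyperbolic space *)

Section EuclideanNorm.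
Context {R : realType}.
Variable d : nat.
Implicit Types (x y : 'rV[R]_d) (i j : 'I_d).

Lemma sumsq_ge0 x : 0 <= \sum_(i < d) x ord0 i ^+ 2.
Proof. by apply: sumr_ge0 => i _; exact: sqr_ge0. Qed.

Lemma enorm_ge0 x : 0 <= enorm x.
Proof. exact: sqrtr_ge0. Qed.

Lemma sqr_enorm x : enorm x ^+ 2 = \sum_(i < d) x ord0 i ^+ 2.
Proof. by rewrite sqr_sqrtr// sumsq_ge0. Qed.

Lemma enormZ (a : R) x : enorm (a *: x) = `|a| * enorm x.
Proof.
rewrite /enorm -sqrtr_sqr -sqrtrM ?sqr_ge0//; congr Num.sqrt.
by rewrite mulr_sumr; apply: eq_bigr => i _; rewrite mxE exprMn.
Qed.

Lemma enorm0 : enorm (0 : 'rV[R]_d) = 0.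
Proof. by rewrite -(scale0r (0 : 'rV[R]_d)) enormZ normr0 mul0r. Qed.

Lemma enorm_coord x i : `|x ord0 i| <= enorm x.
Proof.
rewrite -sqrtr_sqr ler_wsqrtr// (bigD1 i)//= lerDl.
by apply: sumr_ge0 => j _; exact: sqr_ge0.
Qed.

Lemma enorm_eq0 x : (enorm x == 0) = (x == 0).
Proof.
apply/idP/idP => [/eqP x0|/eqP ->]; last by rewrite enorm0.
apply/eqP/rowP => i; rewrite mxE; apply/eqP.
by rewrite -normr_le0 -x0 enorm_coord.
Qed.

Lemma enorm_gt0 x : (0 < enorm x) = (x != 0).
Proof. by rewrite lt_def enorm_ge0 andbT enorm_eq0. Qed.

Lemma enorm_line x i (h : R) : enorm (h *: vecE R i + x) =
  Num.sqrt (enorm x ^+ 2 + 2 * x ord0 i * h + h ^+ 2).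
Proof.
rewrite sqr_enorm /enorm; congr Num.sqrt.
rewrite (bigD1 i)//= [in RHS](bigD1 i)//= !mxE !eqxx mulr1.
rewrite (eq_bigr (fun j => x ord0 j ^+ 2)); first by ring.
by move=> j ji; rewrite !mxE (negPf ji) andbF mulr0 add0r.
Qed.

Lemma cont_sum (T : topologicalType) (I : Type) (r : seq I) (F : I -> T -> R) :
  (forall k, continuous (F k)) -> continuous (fun z => \sum_(k <- r) F k z).
Proof.
move=> cF; elim: r => [|k r IH].
  have -> : (fun z => \sum_(k <- [::]) F k z) = (fun=> 0).
    by apply/funext => z; rewrite big_nil.
  by move=> z; exact: cvg_cst.
have -> : (fun z => \sum_(l <- k :: r) F l z) = (fun z => F k z + \sum_(l <- r) F l z).
  by apply/funext => z; rewrite big_cons.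
by move=> z; apply: cvgD; [exact: cF|exact: IH].
Qed.

Lemma cont_coord i : continuous (fun x : 'rV[R]_d => x ord0 i).
Proof. exact: coord_continuous. Qed.

Lemma cont_enorm : continuous (@enorm R d).
Proof.
move=> x; apply: (@continuous_comp _ _ _ (fun x : 'rV[R]_d => \sum_(i < d) x ord0 i ^+ 2)
   Num.sqrt); last exact: sqrt_continuous.
apply: cont_sum => i y.
apply: (@continuous_comp _ _ _ (fun x : 'rV[R]_d => x ord0 i) (fun t => t ^+ 2)).
  exact: cont_coord.
exact: exprn_continuous.
Qed.

(** Directional derivatives are derivatives along lines. *)
Lemma line_der (f : 'rV[R]_d -> R) x v l :
  der (fun h => f (h *: v + x)) 0 l -> is_derive x v f l.
Proof.
move=> [d1 d2]; apply: DeriveDef; first by apply/derivable1P; exact: d1.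
rewrite -d2 /derive.
have -> // : (fun h : R => h^-1 *: ((f \o shift x) (h *: v) - f x)) =
  (fun h : R => h^-1 *: (((fun h => f (h *: v + x)) \o shift 0) (h *: 1) -
    f (0 *: v + x))).
by apply/funext => h /=; rewrite addr0 scale0r add0r [h *: 1]mulr1.
Qed.

End EuclideanNorm.

Section OneVariable.
Context {R : realType}.
Implicit Types (r s t : R) (F : R -> R).

Lemma der_quadratic F (K : R) : (forall h, `|F h - F 0| <= K * h ^+ 2) -> der F 0 0.
Proof.
move=> FK; apply/is_derive1_caratheodory.
exists (fun z => (F z - F 0) / z); split.
- move=> z; rewrite subr0; have [->|z0] := eqVneq z 0; first by rewrite subrr mulr0.
  by rewrite divfK.
- apply: (@lip_cont _ _ 0 K) => y _; rewrite !subr0 invr0 mulr0 subr0.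
  have [->|y0] := eqVneq y 0; first by rewrite invr0 mulr0 !normr0 mulr0.
  rewrite normrM normfV ler_pdivrMr ?normr_gt0// -mulrA.
  by rewrite -expr2 real_normK ?num_real.
- by rewrite invr0 mulr0.
Qed.

Lemma der_mul_id F (c : R) : {for 0, continuous F} -> der (fun h => F h * (h * c)) 0 (F 0 * c).
Proof.
move=> cF; apply/is_derive1_caratheodory.
exists (fun z => F z * c); split => //.
- by move=> z; rewrite mul0r mulr0 !subr0; ring.
- by apply: continuousM => //; exact: cvg_cst.
Qed.

(** The distance to the origin along a line that misses it. *)
Lemma der_line_norm (r a : R) : 0 < r ->
  der (fun h => Num.sqrt (r ^+ 2 + 2 * a * h + h ^+ 2)) 0 (a / r).
Proof.
move=> r0.
have r2 : 0 < r ^+ 2 + 2 * a * 0 + 0 ^+ 2.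
  by rewrite mulr0 expr0n/= !addr0 exprn_gt0.
have dp : der (fun h => r ^+ 2 + 2 * a * h + h ^+ 2) 0 (2 * a).
  apply: der_ext (derD (derD (der_cst (r ^+ 2) 0) (derZ (2 * a) (der_id 0)))
    (derX 2 (der_id 0))) => //.
  by rewrite expr1; ring.
have ds : der Num.sqrt (r ^+ 2 + 2 * a * 0 + 0 ^+ 2) (2 * r)^-1.
  apply: der_ext (is_derive1_sqrt r2) => //.
  by rewrite mulr0 expr0n/= !addr0 sqrtr_sqr gtr0_norm.
have dc := @der_comp _ Num.sqrt (fun h => r ^+ 2 + 2 * a * h + h ^+ 2) 0 _ _ ds dp.
by apply: der_ext dc => //; field; rewrite gt_eqF.
Qed.

End OneVariable.

(** For a radial function [phi (enorm x)], it is convenient to write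
    [psi r = phi' r / r] and [chi = phi'' - psi]: the gradient is
    [psi (enorm x) *: x] and the Hessian involves only [psi] and [chi]. *)
Section Radial.
Context {R : realType}.
Variables (d : nat) (phi psi chi : R -> R) (K : R).
Hypotheses (cphi : continuous phi) (cpsi : continuous psi) (cchi : continuous chi).
Hypothesis dphi : forall r, 0 < r -> der phi r (r * psi r).
Hypothesis dpsi : forall r, 0 < r -> der psi r (chi r / r).
Hypothesis chi0 : chi 0 = 0.
Hypothesis phiK : forall r, 0 <= r -> `|phi r - phi 0| <= K * r ^+ 2.
Implicit Types (x : 'rV[R]_d) (i j : 'I_d).

Local Notation f := (fun x : 'rV[R]_d => phi (enorm x)).

Let line0 i h : enorm (h *: vecE R i + (0 : 'rV[R]_d)) = `|h|.
Proof. by rewrite enorm_line enorm0 mxE expr0n/= mulr0 mul0r !add0r sqrtr_sqr. Qed.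

Lemma radial_der1 x i :
  is_derive x (vecE R i) f (psi (enorm x) * x ord0 i).
Proof.
apply: line_der; have [->|x0] := eqVneq x 0.
  apply: (@der_ext _ (fun h => phi `|h|)).
  - by apply/funext => h; rewrite line0.
  - by rewrite mxE mulr0.
  - apply: (@der_quadratic _ _ K) => h; rewrite normr0.
    by rewrite (le_trans (phiK (normr_ge0 h)))// real_normK ?num_real.
have r0 : 0 < enorm x by rewrite enorm_gt0.
have G0 : Num.sqrt (enorm x ^+ 2 + 2 * x ord0 i * 0 + 0 ^+ 2) = enorm x.
  by rewrite mulr0 expr0n/= !addr0 sqrtr_sqr gtr0_norm.
have dp := dphi r0; rewrite -{1}G0 in dp.
have dc := @der_comp _ phi (fun h => Num.sqrt (enorm x ^+ 2 + 2 * x ord0 i * h + h ^+ 2))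
  0 _ _ dp (der_line_norm (x ord0 i) r0).
apply: der_ext dc.
- by apply/funext => h; rewrite enorm_line.
- by field; rewrite gt_eqF.
Qed.

Lemma radial_partial i : partial i f = fun x => psi (enorm x) * x ord0 i.
Proof. by apply/funext => x; rewrite /partial; have [_ ->] := radial_der1 x i. Qed.

(* At the origin the quotient reads 0 / 0 = 0 and the second term vanishes. *)
Definition radial_hessian i j x : R := psi (enorm x) * (i == j)%:R +
  chi (enorm x) * (x ord0 i * x ord0 j / enorm x ^+ 2).

Lemma radial_der2 x i j :
  is_derive x (vecE R j) (partial i f) (radial_hessian i j x).
Proof.
rewrite radial_partial; apply: line_der.
have lineE h : (h *: vecE R j + x) ord0 i = h * (i == j)%:R + x ord0 i.
  by rewrite !mxE eqxx.
have [x0|x0] := eqVneq x 0.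
  apply: (@der_ext _ (fun h => psi `|h| * (h * (i == j)%:R))).
  - by apply/funext => h; rewrite lineE x0 line0 mxE addr0.
  - by rewrite /radial_hessian x0 enorm0 mxE !mul0r mulr0 addr0.
  have := @der_mul_id _ (fun h => psi `|h|) (i == j)%:R.
  rewrite normr0; apply.
  by apply: (@continuous_comp _ _ _ (fun h : R => `|h|) psi);
    [exact: norm_continuous|exact: cpsi].
have r0 : 0 < enorm x by rewrite enorm_gt0.
have G0 : Num.sqrt (enorm x ^+ 2 + 2 * x ord0 j * 0 + 0 ^+ 2) = enorm x.
  by rewrite mulr0 expr0n/= !addr0 sqrtr_sqr gtr0_norm.
have dp := dpsi r0; rewrite -{1}G0 in dp.
have d1 := @der_comp _ psi (fun h => Num.sqrt (enorm x ^+ 2 + 2 * x ord0 j * h + h ^+ 2))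
  0 _ _ dp (der_line_norm (x ord0 j) r0).
have d2 := derD (derM (der_id 0) (der_cst (i == j)%:R 0)) (der_cst (x ord0 i) 0).
apply: der_ext (derM d1 d2).
- by apply/funext => h; rewrite enorm_line lineE.
- by rewrite G0 /radial_hessian; field; rewrite gt_eqF.
Qed.

Lemma radial_partial2 i j : partial j (partial i f) = radial_hessian i j.
Proof.
apply/funext => x; rewrite {1}/partial.
by have [_ ->] := radial_der2 x i j.
Qed.

Lemma cont_radial (g : R -> R) : continuous g -> continuous (fun x => g (enorm x)).
Proof.
move=> cg x; apply: (@continuous_comp _ _ _ (@enorm R d) g); last exact: cg.
exact: cont_enorm.
Qed.

Lemma cont_mulrV (F G : 'rV[R]_d -> R) : continuous F -> continuous G ->
  continuous (fun x => F x * G x).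
Proof. by move=> cF cG x; exact: (continuousM (cF x) (cG x)). Qed.

Lemma cont_radial_hessian i j : continuous (radial_hessian i j).
Proof.
have c1 : continuous (fun x : 'rV[R]_d => psi (enorm x) * (i == j)%:R).
  by apply: cont_mulrV; [exact: cont_radial|exact: cst_continuous].
suff c2 : forall x, {for x, continuous (fun x : 'rV[R]_d =>
    chi (enorm x) * (x ord0 i * x ord0 j / enorm x ^+ 2))}.
  by move=> x; apply: (@continuousD _ _ _ _ _ x (c1 x) (c2 x)).
move=> x; have [->|x0] := eqVneq x 0; last first.
  apply: continuousM; first exact: cont_radial.
  apply: continuousM; first by apply: continuousM; exact: cont_coord.
  apply: continuousV; first by rewrite expf_neq0// enorm_eq0.
  apply: (@continuous_comp _ _ _ (@enorm R d) (fun t => t ^+ 2)).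
    exact: cont_enorm.
  exact: exprn_continuous.
pose F (y : 'rV[R]_d) := chi (enorm y) * (y ord0 i * y ord0 j / enorm y ^+ 2).
rewrite -/F; have F0 : F 0 = 0 by rewrite /F enorm0 chi0 mul0r.
rewrite /prop_for /continuous_at F0.
have c0 : (fun y : 'rV[R]_d => chi (enorm y)) @ (0 : 'rV[R]_d) --> (0 : R).
  by have := @cont_radial chi cchi 0; rewrite /continuous_at enorm0 chi0.
have nF : Filter (nbhs (0 : 'rV[R]_d)) by exact: nbhs_filter.
apply/(@cvgr0Pnorm_lt _ _ _ _ nF F) => e e0.
have /(@cvgr0Pnorm_lt _ _ _ _ nF)/(_ e e0) := c0.
apply: filterS => y /=; apply: le_lt_trans; rewrite /F.
rewrite normrM ler_piMr//.
have [->|y0] := eqVneq y 0; first by rewrite enorm0 expr0n/= invr0 mulr0 normr0.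
rewrite normrM [X in _ * X]ger0_norm ?invr_ge0 ?sqr_ge0//.
rewrite ler_pdivrMr ?exprn_gt0 ?enorm_gt0// mul1r normrM expr2.
by rewrite ler_pM// enorm_coord.
Qed.

Lemma radial_C2 : C2 f.
Proof.
split.
- exact: cont_radial.
- by move=> i x; have [] := radial_der1 x i.
- move=> i; rewrite radial_partial.
  by apply: cont_mulrV; [exact: cont_radial|exact: cont_coord].
- by move=> i j x; have [] := radial_der2 x i j.
- by move=> i j; rewrite radial_partial2; exact: cont_radial_hessian.
Qed.

(** The angular term vanishes on radial functions. *)
Lemma radial_sphere_laplacian (r : R) (omega : 'rV[R]_d) : omega != 0 ->
  sphere_laplacian (fun theta => f (r *: theta)) omega = 0.
Proof.
move=> om0; rewrite /sphere_laplacian /euclidean_laplacian big1// => i _.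
set F := fun y : 'rV[R]_d => _.
have Fc y : y != 0 -> F y = phi `|r|.
  move=> y0; rewrite /F /= !enormZ normfV (ger0_norm (enorm_ge0 y)).
  by rewrite mulVf ?mulr1// enorm_eq0.
have near_ne (y : 'rV[R]_d) : y != 0 -> \near y, y != 0.
  move=> y0; have y0' : 0 < enorm y by rewrite enorm_gt0.
  have H := @cvgr_gt _ _ _ _ (@enorm R d) _ (@cont_enorm R d y) 0 y0'.
  by near=> z; rewrite -enorm_gt0; near: z; exact: H.
have near_F (A B : 'rV[R]_d -> R) (y : 'rV[R]_d) : (forall z, z != 0 -> A z = B z) -> y != 0 ->
    \near y, A y = B y.
  by move=> AB /near_ne H; near=> z; apply: AB; near: z; exact: H.
have dF y : y != 0 -> partial i F y = 0.
  move=> y0; have h := near_F F (cst (phi `|r|)) y Fc y0.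
  by rewrite /partial (near_eq_derive _ h) derive_cst.
have h := near_F (partial i F) (cst 0) omega dF om0.
by rewrite {1}/partial (near_eq_derive _ h) derive_cst.
Unshelve. all: by end_near. Qed.

Lemma radial_laplacian0 : hyperbolic_laplacian f 0 = d%:R * psi 0.
Proof.
rewrite /hyperbolic_laplacian eqxx /euclidean_laplacian.
rewrite (eq_bigr (fun=> psi 0)).
  by rewrite sumr_const card_ord mulr_natl.
move=> i _; rewrite radial_partial2 /radial_hessian enorm0 eqxx mxE.
by rewrite !mul0r mulr0 addr0 mulr1.
Qed.

Lemma radial_laplacian x : x != 0 -> hyperbolic_laplacian f x =
  psi (enorm x) + chi (enorm x) +
  (d%:R - 1) * (cosh (enorm x) / sinh (enorm x)) * (enorm x * psi (enorm x)).
Proof.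
move=> x0; rewrite /hyperbolic_laplacian (negPf x0); set r := enorm x.
have r0 : 0 < r by rewrite enorm_gt0.
have om0 : r^-1 *: x != 0 by rewrite scaler_eq0 negb_or invr_eq0 x0 gt_eqF.
have om1 : enorm (r^-1 *: x) = 1.
  by rewrite enormZ gtr0_norm ?invr_gt0// mulVf// gt_eqF.
rewrite radial_sphere_laplacian// mulr0 addr0.
set h := fun s : R => _.
have hE s : 0 < s -> h s = phi s.
  by move=> s0; rewrite /h /= enormZ om1 mulr1 gtr0_norm.
have dh s : 0 < s -> derive1 h s = s * psi s.
  move=> s0; rewrite derive1E; have [_ <-] := dphi s0.
  by apply: near_eq_derive; near=> y; apply: hE; near: y; exact: lt_nbhsr.
rewrite derive1nS derive1n1 dh//; congr (_ + _).
rewrite derive1E (@near_eq_derive _ _ _ _ (fun s : R => s * psi s)).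
  have [_ ->] := derM (der_id r) (dpsi r0).
  by field; rewrite gt_eqF.
by near=> y; apply: dh; near: y; exact: lt_nbhsr.
Unshelve. all: by end_near. Qed.

End Radial.

(** * Regularity at the origin and conclusion *)

Section Origin.
Context {R : realType}.
Implicit Types (s t r : R).

(** Extending a continuous function on the open half line by a constant. *)
Lemma glue_cont (g : R -> R) (c : R) :
  (forall s, 0 < s -> {for s, continuous g}) ->
  (forall e, 0 < e -> exists2 del, 0 < del & forall s, 0 < s < del -> `|g s - c| < e) ->
  continuous (fun s => if s <= 0 then c else g s).
Proof.
move=> cg lim; set G := fun s => _.
have Gneg s : s <= 0 -> G s = c by rewrite /G => ->.
have Gpos s : 0 < s -> G s = g s by rewrite /G leNgt => ->.
move=> x; have [x0|x0] := ltP 0 x.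
  have := cg x x0; rewrite /prop_for /continuous_at Gpos//; apply: cvg_trans.
  by apply: near_eq_cvg; near=> y; rewrite Gpos//; near: y; exact: lt_nbhsr.
rewrite /continuous_at Gneg//; apply/cvgrPdist_lt => e e0.
have [del del0 gd] := lim e e0.
near=> y; have [y0|y0] := leP y 0; first by rewrite Gneg// subrr normr0.
rewrite Gpos// distrC; apply: gd; rewrite y0/=.
have : y - x < del.
  near: y; exists del => //= y /=; rewrite distrC => h.
  exact: le_lt_trans (ler_norm _) h.
by lra.
Unshelve. all: by end_near. Qed.

Section Slope.
Variables (n : nat) (lam p eps : R) (v u : R -> R).
Hypotheses (n0 : (0 < n)%N) (lam0 : 0 < lam) (p0 : 0 < p) (eps0 : 0 <= eps).
Hypothesis (mu1 : lam * eps ^+ 2 <= 1).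
Hypothesis vu : fam n lam p eps v u.

Local Notation f := (nonlin p (lam * eps ^+ 2)).
Local Notation dd := (n.+1%:R : R).

Let he : 0 <= eps <= eps.
Proof. by rewrite eps0 lexx. Qed.

Let hmu : 0 <= lam * eps ^+ 2 <= 1 := mu_itv lam0 eps0 mu1 he.

Let dd0 : 0 < dd.
Proof. by rewrite ltr0n. Qed.

(** [v''(0) = - f(1) / (n + 1)], in the form of a limit of [u s / s]. *)
Lemma u_slope e : 0 < e -> exists2 del, 0 < del &
  forall s, 0 < s < del -> `|u s / s - - (f 1 / dd)| < e.
Proof.
move=> e0; set c := f 1 / dd.
pose A := 1 + `|c|; have A0 : 0 < A by rewrite ltr_wpDr.
pose eta := e / (2 * A); have eta0 : 0 < eta by rewrite divr_gt0// mulr_gt0.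
have ch : continuous (fun t => f 1 * cosh (eps * t) - f (v t)).
  apply: contB; last by apply: cont_comp; [exact: cont_nonlin|exact: (radsol_contv vu)].
  apply: contZ => t; exact: der_cont (der_comp (der_cosh _) (derZ eps (der_id t))).
have cc : continuous (fun t => cosh (eps * t)).
  by move=> t; exact: der_cont (der_comp (der_cosh _) (derZ eps (der_id t))).
have [d1 d10 h1] : exists2 d1, 0 < d1 & forall t, `|t| < d1 ->
    `|f 1 * cosh (eps * t) - f (v t)| < eta.
  have /cvgrPdist_lt/(_ eta eta0)/nbhs_ballP[d1 /= d10 Hd] := ch 0.
  exists d1 => // t td; have := Hd t; rewrite /ball/= sub0r normrN => /(_ td).
  by rewrite mulr0 cosh0 mulr1 (radsol_v0 vu) subrr sub0r normrN.
have [d2 d20 h2] : exists2 d2, 0 < d2 & forall t, `|t| < d2 ->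
    `|cosh (eps * t) - 1| < eta.
  have /cvgrPdist_lt/(_ eta eta0)/nbhs_ballP[d2 /= d20 Hd] := cc 0.
  exists d2 => // t td; have := Hd t; rewrite /ball/= sub0r normrN => /(_ td).
  by rewrite mulr0 cosh0 distrC.
exists (Num.min d1 d2); first by rewrite lt_min d10.
move=> s /andP[s0]; rewrite lt_min => /andP[sd1 sd2].
have b1 : `|u s + c * Sf eps s| <= eta * s.
  have -> : eta * s = eta * s - eta * 0 by rewrite mulr0 subr0.
  apply: (@weight_step R (wt n eps) (fun t => u t + c * Sf eps t)
    (fun t => f 1 * cosh (eps * t) - f (v t)) (fun t => eta * t) (fun=> eta)).
  - exact: weight_wt.
  - by apply: contD; [exact: (radsol_contu vu)|apply: contZ; exact: cont_Sf].
  - by apply: contZ; exact: cont_id.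
  - exact: ltW.
  - move=> t t0.
    have d := derD (radsol_deru vu t0) (derZ c (derX n.+1 (der_Sf eps t))).
    apply: der_ext d.
      by apply/funext => r; rewrite /wt exprS; ring.
    by rewrite /c /wt /=; field; rewrite gt_eqF.
  - by move=> t _; have := derZ eta (der_id t); rewrite mulr1.
  - by move=> t /andP[t0 ts]; rewrite ltW// h1// gtr0_norm// (lt_trans ts).
  - by rewrite (radsol_u0 vu) Sf0 mulr0 addr0.
have b2 : `|Sf eps s - s| <= eta * s.
  have -> : eta * s = eta * s - eta * 0 by rewrite mulr0 subr0.
  have -> : Sf eps s - s = (Sf eps s - s) - (Sf eps 0 - 0) by rewrite Sf0 subrr subr0.
  apply: (@der_bound R (fun t => Sf eps t - t) (fun t => eta * t)
    (fun t => cosh (eps * t) - 1) (fun=> eta)) => [|t _|t _|t _|t _|t /andP[t0 ts]].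
  - exact: ltW.
  - by apply: derB; [exact: der_Sf|exact: der_id].
  - by have := derZ eta (der_id t); rewrite mulr1.
  - by apply: contB; [exact: cont_Sf|exact: cont_id].
  - by apply: contZ; exact: cont_id.
  - by rewrite ltW// h2// gtr0_norm// (lt_trans ts).
have -> : u s / s - - c = (u s + c * s) / s by field; rewrite gt_eqF.
rewrite normrM normfV (gtr0_norm s0) ltr_pdivrMr//.
have -> : u s + c * s = (u s + c * Sf eps s) - c * (Sf eps s - s) by ring.
rewrite (le_lt_trans (ler_normB _ _))// normrM.
have b3 : `|c| * `|Sf eps s - s| <= `|c| * (eta * s) by rewrite ler_wpM2l.
have : eta * A * s < e * s.
  rewrite ltr_pM2r//; have -> : eta * A = e / 2 by rewrite /eta; field; rewrite gt_eqF.
  by lra.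
by rewrite /A; lra.
Qed.

(** [v' s / s], extended by its limit [v''(0)]. *)
Definition slope s := if s <= 0 then - (f 1 / dd) else u s / s.

(** [s * kf eps s], extended by its limit 1. *)
Definition skf s := if s <= 0 then 1 else s * kf eps s.

(** [v'' s - v' s / s], written through the equation to be continuous. *)
Definition defect s := - (n%:R * (skf s * slope s)) - f (v s) - slope s.

Lemma cont_slope : continuous slope.
Proof.
apply: glue_cont => [s s0|]; last exact: u_slope.
apply: continuousM; first exact: (radsol_contu vu).
by apply: continuousV; [rewrite gt_eqF|exact: cvg_id].
Qed.

Lemma cont_skf : continuous skf.
Proof.
apply: glue_cont => [s s0|e e0].
  apply: continuousM; first exact: cvg_id.
  apply: continuousM.
    exact: der_cont (der_comp (der_cosh _) (derZ eps (der_id s))).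
  by apply: continuousV; [rewrite gt_eqF ?Sf_gt0|exact: cont_Sf].
exists (e / (eps + 1)); first by rewrite divr_gt0//; have := eps0; lra.
move=> s /andP[s0 se].
have := kf_lip eps0 (lexx 0) s0; rewrite subr0 (ger0_norm eps0).
have -> : kf 0 s = s^-1 by rewrite /kf /Sf eqxx mul0r cosh0 mul1r.
have -> : s * kf eps s - 1 = s * (kf eps s - s^-1).
  by rewrite mulrBr mulfV// gt_eqF.
rewrite normrM (gtr0_norm s0) => h.
apply: (@le_lt_trans _ _ (s * (eps + 1))).
  by rewrite ler_pM2l//; lra.
by rewrite -ltr_pdivlMr//; have := eps0; lra.
Qed.

Lemma cont_defect : continuous defect.
Proof.
apply: contB; last exact: cont_slope.
apply: contB; last by apply: cont_comp; [exact: cont_nonlin|exact: (radsol_contv vu)].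
apply: contN; apply: contZ; apply: contM; [exact: cont_skf|exact: cont_slope].
Qed.

Lemma defect0 : defect 0 = 0.
Proof.
rewrite /defect /slope /skf lexx (radsol_v0 vu) mul1r -natr1.
by field; rewrite natr1 gt_eqF.
Qed.

Lemma slopeE s : 0 < s -> slope s = u s / s.
Proof. by rewrite /slope leNgt => ->. Qed.

Lemma defectE s : 0 < s ->
  slope s + defect s = - (n%:R * kf eps s * u s) - f (v s).
Proof.
move=> s0; rewrite /defect addrC subrK slopeE// /skf leNgt s0/=.
by congr (- _ - _); field; rewrite gt_eqF.
Qed.

Lemma der_slope s : 0 < s -> der slope s (defect s / s).
Proof.
move=> s0; have sn0 : s != 0 by rewrite gt_eqF.
have d := derM (fam_der_u vu s0) (derV sn0 (der_id s)).
apply: (@der_near _ (fun s => u s * s^-1)).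
  by near=> t; rewrite slopeE//; near: t; exact: lt_nbhsr.
apply: der_ext d => //; rewrite -defectE// slopeE//.
by field.
Unshelve. all: by end_near. Qed.

End Slope.
End Origin.

(** A radial profile, its derivative divided by the radius, and its second
    derivative minus that quotient. *)
Record profile (R : realType) (phi psi chi : R -> R) : Prop := Profile {
  profile_cphi : continuous phi;
  profile_cpsi : continuous psi;
  profile_cchi : continuous chi;
  profile_dphi : forall r, 0 < r -> der phi r (r * psi r);
  profile_dpsi : forall r, 0 < r -> der psi r (chi r / r);
  profile_chi0 : chi 0 = 0;
  profile_quad : exists K, forall r, 0 <= r -> `|phi r - phi 0| <= K * r ^+ 2
}.

Section Profile.
Context {R : realType}.

Lemma profileZ (c : R) (phi psi chi : R -> R) : profile phi psi chi ->
  profile (fun r => c * phi r) (fun r => c * psi r) (fun r => c * chi r).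
Proof.
move=> [c1 c2 c3 d1 d2 h0 [K hK]]; split; try exact: contZ.
- by move=> r r0; apply: der_ext (derZ c (d1 r r0)) => //; ring.
- by move=> r r0; apply: der_ext (derZ c (d2 r r0)) => //; ring.
- by rewrite h0 mulr0.
- exists (`|c| * K) => r r0; rewrite -mulrBr normrM -mulrA ler_wpM2l//.
  exact: hK.
Qed.

Lemma profile_C2 (d : nat) (phi psi chi : R -> R) : profile phi psi chi ->
  C2 (fun x : 'rV[R]_d => phi (enorm x)).
Proof.
by move=> [c1 c2 c3 d1 d2 h0 [K hK]]; exact: (radial_C2 d c1 c2 c3 d1 d2 h0 hK).
Qed.

Lemma profile_laplacianZ (d : nat) (c : R) (phi psi chi : R -> R) (x : 'rV[R]_d) :
  profile phi psi chi ->
  hyperbolic_laplacian (fun x => c * phi (enorm x)) x =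
  c * hyperbolic_laplacian (fun x => phi (enorm x)) x.
Proof.
move=> P; have [c1 c2 c3 d1 d2 h0 [K hK]] := P.
have [c1' c2' c3' d1' d2' h0' [K' hK']] := profileZ c P.
have [->|x0] := eqVneq x 0.
  rewrite (radial_laplacian0 d c2 d1 d2 hK) (radial_laplacian0 d c2' d1' d2' hK').
  by ring.
rewrite (radial_laplacian d1 d2 x0) (radial_laplacian d1' d2' x0).
by ring.
Qed.

(** The profile [phi r = eps ^ (- 2 / p) * v (r / eps)], where [v] is given by
    [shooting]. *)
Lemma ground_profile (n : nat) (lam p : R) : (0 < n)%N -> 0 < lam -> 0 < p ->
  (n%:R - 1) * p < 4 ->
  exists phi psi chi, [/\ profile phi psi chi,
    forall r, 0 <= r -> 0 < phi r,
    forall r t, 0 <= r -> r < t -> phi t < phi r,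
    n.+1%:R * psi 0 = lam * phi 0 - phi 0 `^ (p + 1) &
    forall r, 0 < r -> psi r + chi r + n%:R * (cosh r / sinh r) * (r * psi r) =
      lam * phi r - phi r `^ (p + 1)].
Proof.
move=> n0 lam0 p0 sub.
have [eps [v [u [e0 mu1 vu un vpos]]]] := shooting n0 lam0 p0 sub.
have en0 : eps != 0 by rewrite gt_eqF.
have e0' := ltW e0; have mu1' := ltW mu1.
(* The amplitude is fixed by a ^ p * eps ^ 2 = 1. *)
pose a := (eps ^+ 2) `^ (- p^-1).
have a0 : 0 < a by rewrite powR_gt0// exprn_gt0.
have ap : a `^ p = (eps ^+ 2)^-1.
  rewrite /a -powRrM mulNr mulVf ?gt_eqF// powR_inv1// sqr_ge0//.
pose b := a / eps ^+ 2.
have he : 0 <= eps <= eps by rewrite e0' lexx.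
pose phi r := a * v (eps^-1 * r).
pose psi r := b * slope n lam p eps u (eps^-1 * r).
pose chi r := b * defect n lam p eps v u (eps^-1 * r).
have pos r : 0 < r -> 0 < eps^-1 * r by move=> r0; rewrite mulr_gt0// invr_gt0.
have pos' r : 0 <= r -> 0 <= eps^-1 * r by move=> r0; rewrite mulr_ge0// invr_ge0.
have cs : continuous (fun r => eps^-1 * r) by apply: contZ; exact: cont_id.
have ds r : der (fun r => eps^-1 * r) r eps^-1.
  by have := derZ eps^-1 (der_id r); rewrite mulr1.
exists phi, psi, chi; split.
- split.
  + by apply: contZ; apply: cont_comp => //; exact: (radsol_contv vu).
  + apply: contZ; apply: cont_comp => //.
    exact: (cont_slope n0 lam0 p0 e0' mu1' vu).
  + apply: contZ; apply: cont_comp => //.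
    exact: (cont_defect n0 lam0 p0 e0' mu1' vu).
  + move=> r r0.
    apply: der_ext (derZ a (der_comp (radsol_derv vu (pos r r0)) (ds r))) => //.
    by rewrite /psi /b slopeE ?pos//; field; rewrite en0 gt_eqF.
  + move=> r r0.
    apply: der_ext (derZ b (der_comp (der_slope vu (pos r r0)) (ds r))) => //.
    by rewrite /chi /b; field; rewrite en0 gt_eqF.
  + by rewrite /chi mulr0 (defect0 vu) mulr0.
  + exists (a * (eps^-1 ^+ 2 / 2)) => r r0.
    rewrite /phi mulr0 (radsol_v0 vu) -mulrBr normrM (gtr0_norm a0) -mulrA ler_pM2l//.
    apply: le_trans (fam_v_le n0 lam0 p0 e0' mu1' he vu (pos' r r0)) _.
    by rewrite exprMn; lra.
- by move=> r r0; have /andP[h _] := vpos _ (pos' r r0); rewrite mulr_gt0.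
- move=> r t r0 rt; rewrite ltr_pM2l//; apply: (v_decr vu); first exact: pos'.
    by rewrite ltr_pM2l ?invr_gt0.
  by move=> s /andP[h _]; apply: un; exact: le_lt_trans (pos' r r0) h.
- rewrite /phi /psi mulr0 (radsol_v0 vu) mulr1 /slope lexx.
  rewrite nonlinE ?ler01 ?lexx// powR1 (powRS p0 (ltW a0)) ap /b.
  by field; rewrite en0 nat1r pnatr_eq0.
move=> r r0; have s0 := pos r r0.
have /andP[vs0 vs1] := vpos _ (ltW s0).
rewrite /psi /chi /phi -mulrDr (@defectE R n lam p eps v u _ s0) nonlinE; last by rewrite ltW.
rewrite powRM ?(ltW a0) ?(ltW vs0)// (powRS p0 (ltW a0)) ap slopeE//.
have er : eps * (eps^-1 * r) = r by rewrite mulrA mulfV// mul1r.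
rewrite /kf /Sf (negPf en0) er /b.
have sh : sinh r != 0.
  by have := Sf_gt0 1 r0; rewrite /Sf oner_eq0 mul1r divr1 => /gt_eqF ->.
by field; rewrite en0 sh gt_eqF.
Qed.

End Profile.

Section Standing.
Context {R : realType}.

(** A positive solution of the stationary equation yields a standing wave. *)
Lemma standing_wave (d : nat) (lam p : R) (phi psi chi : R -> R) :
  profile phi psi chi -> 0 < p -> (forall r, 0 <= r -> 0 < phi r) ->
  (forall x : 'rV[R]_d, hyperbolic_laplacian (fun x => phi (enorm x)) x =
    lam * phi (enorm x) - phi (enorm x) `^ (p + 1)) ->
  nls_solution p (fun (t : R) (x : 'rV[R]_d) => cis (lam * t) * (phi (enorm x))%:C).
Proof.
move=> P p0 pos eqn.
have Re t : ReF (fun x : 'rV[R]_d => cis (lam * t) * (phi (enorm x))%:C) =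
    fun x => cos (lam * t) * phi (enorm x).
  by apply/funext => x; rewrite /ReF /= mulr0 subr0.
have Im t : ImF (fun x : 'rV[R]_d => cis (lam * t) * (phi (enorm x))%:C) =
    fun x => sin (lam * t) * phi (enorm x).
  by apply/funext => x; rewrite /ImF /= mulr0 add0r mulrC.
have dRe (c t : R) : der (fun s => cos (lam * s) * c) t (- (lam * sin (lam * t) * c)).
  have dc := der_comp (is_derive_cos (lam * t)) (derZ lam (der_id t)).
  by apply: der_ext (derM dc (der_cst c t)) => //; ring.
have dIm (c t : R) : der (fun s => sin (lam * s) * c) t (lam * cos (lam * t) * c).
  have dc := der_comp (is_derive_sin (lam * t)) (derZ lam (der_id t)).
  by apply: der_ext (derM dc (der_cst c t)) => //; ring.
have ReT (x : 'rV[R]_d) : ReF (fun s => cis (lam * s) * (phi (enorm x))%:C) =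
    fun s => cos (lam * s) * phi (enorm x).
  by apply/funext => t; rewrite /ReF /= mulr0 subr0.
have ImT (x : 'rV[R]_d) : ImF (fun s => cis (lam * s) * (phi (enorm x))%:C) =
    fun s => sin (lam * s) * phi (enorm x).
  by apply/funext => t; rewrite /ImF /= mulr0 add0r mulrC.
split.
- move=> t; rewrite Re Im.
  by split; apply: profile_C2 (profileZ _ P).
- move=> t x; split; [rewrite ReT|rewrite ImT].
    by have [] := dRe (phi (enorm x)) t.
  by have [] := dIm (phi (enorm x)) t.
move=> t x; set c := cos (lam * t); set s := sin (lam * t).
have px := pos _ (enorm_ge0 x).
have -> : cderive (fun s => cis (lam * s) * (phi (enorm x))%:C) t =
    (- (lam * s * phi (enorm x))) +i* (lam * c * phi (enorm x)).
  rewrite /cderive ReT ImT !derive1E.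
  by have [_ ->] := dRe (phi (enorm x)) t; have [_ ->] := dIm (phi (enorm x)) t.
rewrite /hyperbolic_claplacian Re Im !(profile_laplacianZ _ _ P) eqn -/c -/s.
have -> : cis (lam * t) * (phi (enorm x))%:C = (c * phi (enorm x)) +i* (s * phi (enorm x)).
  by rewrite /cis -/c -/s; simpc.
have -> : Normc.normc ((c * phi (enorm x)) +i* (s * phi (enorm x))) = phi (enorm x).
  rewrite /Normc.normc !exprMn -mulrDl cos2Dsin2 mul1r sqrtr_sqr gtr0_norm//.
rewrite (powRS p0 (ltW px)).
set q := phi (enorm x) `^ p.
apply/eqP; rewrite eq_complex /=; apply/andP; split; apply/eqP; ring.
Qed.

End Standing.

Theorem theorem1 (R : realType) (d : nat) (hd : (2 <= d)%N) (lambda p : R)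
    (hlambda : (d%:R - 1) ^+ 2 / 4 < lambda)
    (hp0 : 0 < p) (hp : (2 < d)%N -> p < 4 / (d%:R - 2)) :
  exists (u : R -> hyperbolic R d -> R[i]) (Rl : hyperbolic R d -> R),
    [/\ nls_solution p u,
        forall (t : R) (x : hyperbolic R d), u t x = cis (lambda * t) * (Rl x)%:C,
        stationary_solution lambda p Rl &
        [/\ forall x : hyperbolic R d, 0 < Rl x,
            radially_decreasing Rl &
            spherically_symmetric Rl]].
Proof.
case: d hd hlambda hp => [//|n] hd hlambda hp.
have n0 : (0 < n)%N by [].
have lam0 : 0 < lambda.
  by apply: le_lt_trans hlambda; rewrite divr_ge0// sqr_ge0.
have nE : n.+1%:R - 1 = n%:R :> R by rewrite -natr1 addrK.
have sub : (n%:R - 1) * p < 4.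
  case: n n0 hp {hd hlambda nE} => [//|[|m]] _ hp; first by rewrite subrr mul0r.
  have := hp isT; have -> : m.+3%:R - 2 = m.+2%:R - 1 :> R by rewrite -natr1; ring.
  by rewrite ltr_pdivlMr 1?mulrC// -natr1 addrK ltr0n.
have [phi [psi [chi [P pos dec eq0 eqn]]]] := ground_profile n0 lam0 hp0 sub.
have [c1 c2 c3 d1 d2 h0 [K hK]] := P.
have lap (x : 'rV[R]_n.+1) : hyperbolic_laplacian (fun x => phi (enorm x)) x =
    lambda * phi (enorm x) - phi (enorm x) `^ (p + 1).
  have [->|x0] := eqVneq x 0.
    by rewrite (radial_laplacian0 n.+1 c2 d1 d2 hK) enorm0.
  rewrite (radial_laplacian d1 d2 x0) nE; apply: eqn.
  by rewrite enorm_gt0.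
exists (fun t x => cis (lambda * t) * (phi (enorm x))%:C), (fun x => phi (enorm x)).
split => //.
- exact: standing_wave P hp0 pos lap.
- split; first exact: profile_C2 P.
  by move=> x; rewrite lap; ring.
split.
- by move=> x; apply: pos; exact: enorm_ge0.
- by move=> x y; apply: dec; exact: enorm_ge0.
- by move=> x y ->.
Qed.
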